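(* Let $\kappa$ be a weakly compact cardinal. Then the following statements are equivalent for every partial order $\mathbb{P}$: (1) $\mathbb{P}$ satisfies the $\kappa$-chain condition; (2) $\mathbb{P}$ is $\kappa$-Knaster; (3) $\mathbb{P}$ is $\kappa$-stationarily layered; (4) $\mathbb{P}$ is completely $\mathcal{F}_{wc(\kappa)}$-layered.
   Context: A suborder $\mathbb{Q}\subseteq\mathbb{P}$ (with the induced order) is a regular suborder if the inclusion map preserves incompatibility and every maximal antichain of $\mathbb{Q}$ is a maximal antichain of $\mathbb{P}$. For a cardinal $\kappa$, $\mathrm{Reg}_\kappa(\mathbb{P})$ is the set of regular suborders of $\mathbb{P}$ of cardinality less than $\kappa$. Stationarity in $\mathcal{P}_\kappa(A)$ is in Jech's sense: a set $C\subseteq\mathcal{P}_\kappa(A)$ is club if it is $\subseteq$-cofinal in $\mathcal{P}_\kappa(A)$ and closed under unions of $\subseteq$-increasing chains of length less than $\kappa$; $S$ is stationary if it meets every club. For uncountable regular $\kappa$, $\mathbb{P}$ is $\kappa$-stationarily layered if $\mathrm{Reg}_\kappa(\mathbb{P})$ is stationary in $\mathcal{P}_\kappa(\mathbb{P})$. $\mathbb{P}$ is $\kappa$-Knaster if every $\kappa$-sized set of conditions has a $\kappa$-sized subset of pairwise compatible conditions. For a cardinal $\lambda\ge\kappa$ and a filter $\mathcal{F}$ on $\mathcal{P}_\kappa(\lambda)$: a partial order $\mathbb{P}$ is $\mathcal{F}$-layered if $|\mathbb{P}|\le\lambda$ and $\{a\in\mathcal{P}_\kappa(\lambda): s[a]\in\mathrm{Reg}_\kappa(\mathbb{P})\}\in\mathcal{F}$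 for every surjection $s:\lambda\to\mathbb{P}$; $\mathbb{P}$ is completely $\mathcal{F}$-layered if every subset of $\mathbb{P}$ of cardinality at most $\lambda$ is contained in a regular suborder of $\mathbb{P}$ of cardinality at most $\lambda$, and every regular suborder of $\mathbb{P}$ of cardinality at most $\lambda$ is $\mathcal{F}$-layered. For weakly compact $\kappa$, the weakly compact filter $\mathcal{F}_{wc(\kappa)}$ on $\mathcal{P}_\kappa(\kappa)$ (here $\lambda=\kappa$) is the filter generated by the sets $R_{\Phi,A,a}=\{\alpha<\kappa: V_\alpha\models\Phi(A\cap V_\alpha,a)\}$, where $\Phi$ is a $\Pi^1_1$-formula, $A\subseteq V_\kappa$, $a\in V_\kappa$ and $V_\kappa\models\Phi(A,a)$; these sets of ordinals are viewed as subsets of $\mathcal{P}_\kappa(\kappa)$. *)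

(* Defs.v *)
From HB Require Import structures.
From mathcomp Require Import all_boot all_order.
From mathcomp Require Import boolp classical_sets functions wochoice.
From mathcomp Require Import cardinality filter.

Set Implicit Arguments.
Unset Strict Implicit.
Unset Printing Implicit Defensive.

Local Open Scope classical_set_scope.
Local Open Scope card_scope.

(* A cardinal kappa is given by a type K with a well-order le all of whose
   proper initial segments have smaller cardinality than K. The elements of K
   are the ordinals below kappa, and an ordinal alpha <= kappa is the same as an
   initial segment of K: [below le a] for a : K, or [set: K] for kappa itself. *)

(* The carrier of kappa and the index types of the sets [Ens] below live in the
   same universe, so that the hierarchy V_alpha, alpha <= kappa, is not
   truncated by a universe bound. *)
Definition smallType := Type.

Definition card_lt {T U} (A : set T) (B : set U) : Prop :=
  A #<= B /\ ~ (B #<= A).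

Definition below {K : Type} (le : rel K) (a : K) : set K :=
  [set b | le b a /\ b <> a].

Definition is_cardinal {K : Type} (le : rel K) : Prop :=
  well_order le /\ forall a, card_lt (below le a) [set: K].

(* kappa is uncountable and kappa --> (kappa)^2_2; a colouring of [kappa]^2 is
   read off the pairs x < y. *)
Definition weakly_compact {K : Type} (le : rel K) : Prop :=
  [/\ is_cardinal le,
      ~ countable [set: K] &
      forall c : K -> K -> bool, exists H : set K,
        H #= [set: K] /\
        exists i, forall x y, H x -> H y -> below le y x -> c x y = i].

Definition Pk (K T : Type) : set (set T) := [set a | card_lt a [set: K]].
Arguments Pk K T : clear implicits.

Section Stationary.
Context {K T : Type} (le : rel K).

(* Chains are indexed by the nonzero ordinals below kappa. *)
Definition club (C : set (set T)) : Prop :=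
  [/\ C `<=` Pk K T,
      forall X, Pk K T X -> exists2 Y, C Y & X `<=` Y &
      forall (g : K) (X : K -> set T),
        below le g !=set0 ->
        (forall x, below le g x -> C (X x)) ->
        (forall x y, below le g x -> below le g y -> le x y -> X x `<=` X y) ->
        C (\bigcup_(x in below le g) X x)].

Definition stationary (S : set (set T)) : Prop :=
  S `<=` Pk K T /\ forall C, club C -> S `&` C !=set0.

End Stationary.

(* A suborder is a subset Q : set P with the induced order; compatibility,
   antichains and regular suborders are relative to such a Q. *)
Section Suborders.
Context {d : Order.disp_t} {P : porderType d}.
Implicit Types (A B Q R X : set P) (p q r : P).

Definition compatible Q p q : Prop :=
  exists r, [/\ Q r, (r <= p)%O & (r <= q)%O].

Definition antichain Q A : Prop :=
  A `<=` Q /\ forall p q, A p -> A q -> p <> q -> ~ compatible Q p q.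

Definition maximal_antichain Q A : Prop :=
  antichain Q A /\ forall B, antichain Q B -> A `<=` B -> B = A.

Definition regular_suborder Q R : Prop :=
  [/\ R `<=` Q,
      forall p q, R p -> R q -> ~ compatible R p q -> ~ compatible Q p q &
      forall A, maximal_antichain R A -> maximal_antichain Q A].

Definition Reg (K : Type) Q : set (set P) :=
  [set R | regular_suborder Q R /\ card_lt R [set: K]].

(* F is a filter on P_kappa(lambda), where lambda is carried by L. *)
Definition layered {K L : Type} (F : set_system (Pk K L)) Q : Prop :=
  Q #<= [set: L] /\
  forall s : L -> P, range s = Q -> F [set a | Reg K Q (s @` set_val a)].

End Suborders.

Section Properties.
Context {d : Order.disp_t} (P : porderType d).

Definition chain_condition (K : Type) : Prop :=
  forall A : set P, antichain [set: P] A -> card_lt A [set: K].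

Definition Knaster (K : Type) : Prop :=
  forall A : set P, A #= [set: K] ->
    exists B : set P, [/\ B `<=` A, B #= [set: K] &
      forall p q, B p -> B q -> compatible [set: P] p q].

Definition stationarily_layered {K : Type} (le : rel K) : Prop :=
  stationary le (Reg K [set: P]).

Definition completely_layered {K L : Type} (F : set_system (Pk K L)) : Prop :=
  (forall X : set P, X #<= [set: L] ->
     exists Q, [/\ regular_suborder [set: P] Q, Q #<= [set: L] & X `<=` Q]) /\
  (forall Q : set P, regular_suborder [set: P] Q -> Q #<= [set: L] ->
     layered F Q).

End Properties.

(* Aczel's sets-as-trees; equality of sets is the bisimulation [Eeq]. *)
Inductive Ens : Type := MkEns (A : smallType) (f : A -> Ens).

Fixpoint Eeq (x y : Ens) : Prop :=
  let: MkEns A f := x in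
  let: MkEns B g := y in
  (forall i, exists j, Eeq (f i) (g j)) /\ (forall j, exists i, Eeq (f i) (g j)).

Definition Emem (x y : Ens) : Prop :=
  let: MkEns B g := y in exists j, Eeq x (g j).

(* Subsets of M; only predicates invariant under [Eeq] denote such subsets. *)
Definition subclass (M X : set Ens) : Prop :=
  X `<=` M /\ forall x y, Eeq x y -> X x -> X y.

(* V_alpha is the union of the power sets of the V_beta, beta < alpha;
   here alpha <= kappa is the initial segment D. *)
Fixpoint Vstage {K : smallType} (le : rel K) (D : set K) (x : Ens) : Prop :=
  let: MkEns A f := x in exists2 b, D b & forall i, Vstage le (below le b) (f i).

(* First-order formulas over set variables and class (second-order) variables,
   both as de Bruijn indices. *)
Inductive fo : Type :=
  | FMem (i j : nat)
  | FEq (i j : nat)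
  | FIn (i k : nat) (* set variable i belongs to class variable k *)
  | FBot
  | FImp (phi psi : fo)
  | FAll (phi : fo).

Inductive pi11 : Type :=
  | Matrix (phi : fo)
  | ForallClass (Phi : pi11).

Definition scons {T : Type} (x : T) (e : nat -> T) (n : nat) : T :=
  if n is m.+1 then e m else x.

Fixpoint fo_sat (M : set Ens) (X : nat -> set Ens) (e : nat -> Ens) (phi : fo)
    : Prop :=
  match phi with
  | FMem i j => Emem (e i) (e j)
  | FEq i j => Eeq (e i) (e j)
  | FIn i k => X k (e i)
  | FBot => False
  | FImp phi psi => fo_sat M X e phi -> fo_sat M X e psi
  | FAll phi => forall x, M x -> fo_sat M X (scons x e) phi
  end.

Fixpoint pi11_sat (M : set Ens) (X : nat -> set Ens) (e : nat -> Ens)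
    (Phi : pi11) : Prop :=
  match Phi with
  | Matrix phi => fo_sat M X e phi
  | ForallClass Phi =>
      forall Y, subclass M Y -> pi11_sat M (scons Y X) e Phi
  end.

(* M |= Phi(A, a): all free class variables of Phi denote A and all its free
   set variables denote a, so Phi has in effect one free variable per sort. *)
Definition models (M : set Ens) (Phi : pi11) (A : set Ens) (a : Ens) : Prop :=
  pi11_sat M (fun=> A) (fun=> a) Phi.

Section WeaklyCompactFilter.
Context {K : smallType} (le : rel K).

(* Ordinals alpha < kappa are viewed as elements of P_kappa(kappa); evaluating
   Phi(A cap V_alpha, a) in V_alpha presupposes that a is in V_alpha. *)
Definition reflection_set (Phi : pi11) (A : set Ens) (a : Ens)
    : set (Pk K K) :=
  [set x | exists alpha : K,
     [/\ set_val x = below le alpha,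
         Vstage le (below le alpha) a &
         models (Vstage le (below le alpha)) Phi (A `&` Vstage le (below le alpha)) a]].

Definition wc_filter : set_system (Pk K K) :=
  smallest Filter
    [set R | exists Phi A a,
       [/\ subclass (Vstage le [set: K]) A, Vstage le [set: K] a,
           models (Vstage le [set: K]) Phi A a & R = reflection_set Phi A a]].

End WeaklyCompactFilter.

(* Main.v *)
(* From kappa --> (kappa)^2_2 one gets that kappa is regular, that given kappa many
   subsets of kappa some H of size kappa is, up to a bounded part, contained in or
   disjoint from each of them, that kappa is a strong limit, and finally that given
   kappa many regressive functions some H of size kappa has all of them eventually
   constant on H. A set is [large] if it contains a tail of every H stabilising a
   suitable family of regressive functions; the large sets form a proper filter.

   The partition property makes every kappa-c.c. order kappa-Knaster. If P is
   kappa-c.c., a continuous chain of small suborders closed under witnesses of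
   compatibility and of non-maximality of antichains has a regular union, and a
   large set of its members are regular: this gives stationary layering, and
   regular suborders of size kappa over any kappa many conditions.
   That s[alpha] is regular in Q follows from alpha being closed under a function
   and from the reflection to V_alpha of "every maximal antichain is bounded", so Q
   is layered. Conversely, by a Los argument for V_kappa as the limit of the
   V_alpha along H, the generators of the weakly compact filter are large. Given a
   maximal antichain A of size at least kappa, the small suborders on which A has a
   maximal trace contain a club (resp. a large set), and a regular one among them
   would contain A. *)
Require Import Defs.
From mathcomp Require Import all_boot all_order.
From mathcomp Require Import boolp classical_sets functions wochoice.
From mathcomp Require Import cardinality filter.

Set Implicit Arguments.
Unset Strict Implicit.
Unset Printing Implicit Defensive.

Local Open Scope classical_set_scope.
Local Open Scope card_scope.

(** * Cardinality *)

Lemma card_le_inj {T U} (A : set T) (B : set U) (f : T -> U) :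
  (forall x, A x -> B (f x)) ->
  (forall x y, A x -> A y -> f x = f y -> x = y) -> A #<= B.
Proof.
move=> fAB finj.
have [g] : $|{injfun A >-> B}|; last exact: inj_card_le.
apply/injfunPex; exists f => // x y; rewrite !inE; exact: finj.
Qed.

Lemma card_le_surj {T U} (A : set T) (B : set U) (f : T -> U) :
  (forall y, B y -> exists2 x, A x & f x = y) -> B #<= A.
Proof.
move=> fAB; apply: card_le_trans (card_image_le f A).
by apply: subset_card_le => y /fAB[x Ax <-]; exists x.
Qed.

Lemma card_le_fun {T U} (u0 : U) (A : set T) (B : set U) : A #<= B ->
  exists2 f : T -> U, forall x, A x -> B (f x) &
    forall x y, A x -> A y -> f x = f y -> x = y.
Proof.
move=> /card_leP[f].
pose g x := if pselect (A x) is left p then set_val (f (SigSub (mem_set p))) else u0.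
exists g => [x Ax|x y Ax Ay]; rewrite /g.
  by case: pselect => // p; apply: set_valP.
case: pselect => // p; case: pselect => // q /val_inj E.
by have [] : SigSub (mem_set p) = SigSub (mem_set q) :> A
  by apply: (@inj _ _ _ f); rewrite ?inE.
Qed.

(** * Consequences of the partition property *)

Section WeaklyCompact.
Context {K : Type} {le : rel K} (hK : weakly_compact le).

Local Notation "x ≺ y" := (below le y x) (at level 70, no associativity).

Let wo : well_order le. Proof. by case: hK => -[]. Qed.

(** * Order and recursion on kappa *)

Lemma exists_min (A : set K) : A !=set0 -> exists2 z, A z & forall x, A x -> le z x.
Proof.
move=> [a Aa]; have [|z [[Az lez] _]] := wo (A := mem A); first by exists a; apply/mem_set.
by exists z => [|x Ax]; [exact: set_mem|apply: lez; exact: mem_set].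
Qed.

Lemma lexx : reflexive le.
Proof. by move=> x; have [|z -> ] := @exists_min [set x]; [exists x|apply]. Qed.

Lemma le_total x y : le x y \/ le y x.
Proof.
have [|z zxy zmin] := @exists_min [set x; y]; first by exists x; left.
by case: zxy => <-; [left|right]; apply: zmin; [right|left].
Qed.

Lemma le_anti x y : le x y -> le y x -> x = y.
Proof.
move=> xy yx; have [|z [_ zu]] := wo (A := mem [set x; y]).
  by exists x; apply/mem_set; left.
have <- : z = x. 
  apply: zu; split=> [|t]; first by apply/mem_set; left.
  by move=> /set_mem[] ->; rewrite ?lexx.
by apply: zu; split=> [|t]; [apply/mem_set; right|move=> /set_mem[] ->; rewrite ?lexx].
Qed.

Lemma le_trans y x z : le x y -> le y z -> le x z.
Proof.
move=> xy yz; have [|t tA tmin] := @exists_min [set x; y; z].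
  by exists x; left; left.
have tx : le t x by apply: tmin; left; left.
have ty : le t y by apply: tmin; left; right.
have tz : le t z by apply: tmin; right.
case: tA tx ty tz => [[->|->]|->] tx ty tz //.
  by rewrite (le_anti xy tx).
by rewrite -(le_anti yz ty).
Qed.

Lemma ltW x y : x ≺ y -> le x y. Proof. by case. Qed.

Lemma ltNge x y : x ≺ y <-> ~ le y x.
Proof.
split=> [[xy nxy] yx|nyx]; first exact/nxy/le_anti.
by have [xy|//] := le_total x y; split=> // E; apply: nyx; rewrite E lexx.
Qed.

Lemma ltxx x : ~ x ≺ x. Proof. by case. Qed.

Lemma leNgt x y : le x y <-> ~ y ≺ x.
Proof. by rewrite ltNge; split=> [xy|/contrapT//]; apply. Qed.



Lemma le_lt_trans y x z : le x y -> y ≺ z -> x ≺ z.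
Proof. by move=> xy /ltNge yz; apply/ltNge => zx; apply/yz/(le_trans zx). Qed.

Lemma lt_trans y x z : x ≺ y -> y ≺ z -> x ≺ z.
Proof. by move=> /ltW; exact: le_lt_trans. Qed.

Lemma le_eqVlt x y : le x y -> x = y \/ x ≺ y.
Proof. by move=> xy; case: (EM (x = y)) => [->|]; [left|right]. Qed.

Lemma lt_total x y : x <> y -> x ≺ y \/ y ≺ x.
Proof. by move=> xy; case: (le_total x y) => ?; [left|right]; split=> // /esym. Qed.

Lemma lt_wf : well_founded (fun x y => x ≺ y).
Proof.
move=> x; apply: contrapT => nx.
have [|z nz zmin] := @exists_min [set x | ~ Acc (fun x y => x ≺ y) x]; first by exists x.
by apply: nz; split=> y /ltNge yz; apply: contrapT => /zmin.
Qed.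

Lemma wf_rec {T} (t0 : T) (F : K -> (K -> T) -> T) :
  (forall x f g, (forall y, y ≺ x -> f y = g y) -> F x f = F x g) ->
  exists h : K -> T, forall x, h x = F x h.
Proof.
move=> Fext.
(* [t0] is a default; by [Fext], [F x] looks only at values below [x]. *)
pose G x (rec : forall y, y ≺ x -> T) :=
  F x (fun y => if pselect (y ≺ x) is left p then rec y p else t0).
exists (Fix lt_wf _ G) => x; rewrite Fix_eq.
  by apply: Fext => y yx; case: pselect.
by move=> {}x f g fg; apply: Fext => y yx; case: pselect.
Qed.

(** * Sets of size less than kappa *)

Definition small {T} (A : set T) : bool := ~~ ([set: K] #<= A).

Lemma inhK : inhabited K.
Proof.
case: hK => _ + _; apply: contra_notP => nK.
by apply: (card_le_inj (f := fun=> 0%N)) => // x; case: nK; exists.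
Qed.

Lemma bigP {T} (A : set T) : ~ small A <->
  exists2 h : K -> T, forall k, A (h k) & injective h.
Proof.
split=> [/negP/negbNE KA|[h hA hi] /negP]; last first.
  by apply; apply: (card_le_inj (f := h)) => // x y _ _ /hi.
have [k0] := inhK.
have [t0 _] : A !=set0.
  apply/set0P/eqP => A0; by have : [set: K] k0 by []; rewrite A0 in KA; rewrite (card_le0P _ _ KA).
have [h hA hi] := card_le_fun t0 KA; exists h => [k|x y]; [exact: hA|exact: hi].
Qed.

Lemma big_setT : ~ small [set: K].
Proof. by rewrite /small card_lexx. Qed.

Lemma card_le_small {T U} (A : set T) (B : set U) : A #<= B -> small B -> small A.
Proof. by move=> AB; apply: contra => KA; apply: card_le_trans KA AB. Qed.

Lemma sub_small {T} (A B : set T) : A `<=` B -> small B -> small A.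
Proof. by move=> /subset_card_le; exact: card_le_small. Qed.

Lemma image_small {T U} (f : T -> U) (A : set T) : small A -> small (f @` A).
Proof. exact/card_le_small/card_image_le. Qed.

Lemma countable_small {T} (A : set T) : countable A -> small A.
Proof. by case: hK => _ nK _ cA; apply/negP => KA; apply/nK/(card_le_trans KA). Qed.

Lemma small1 {T} (x : T) : small [set x].
Proof. exact/countable_small/countable1. Qed.

Lemma small0 {T} : small (@set0 T).
Proof. exact/countable_small/countable0. Qed.

Lemma homogeneous (c : K -> K -> bool) : exists2 H : set K, ~ small H &
  exists i, forall x y, H x -> H y -> x ≺ y -> c x y = i.
Proof.
case: hK => _ _ /(_ c)[H [HK cH]]; exists H => //; apply/negP/negPn.
by move: HK; rewrite card_eq_le => /andP[].
Qed.

(** Regularity of kappa: colour a pair by whether its two values lie in the same chosen piece. A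
    homogeneous set injects by [h] into one piece, or by [f] into [I]. *)
Lemma small_bigcup {J T} (I : set J) (A : J -> set T) :
  small I -> (forall i, I i -> small (A i)) -> small (\bigcup_(i in I) A i).
Proof.
move=> sI sA; apply: contrapT => /bigP[h hA hi].
have /choice[f fA] k : exists i, I i /\ A i (h k) by have [i] := hA k; exists i.
have [H bH [[] cH]] := homogeneous (fun x y => `[< f x = f y >]).
  have [x Hx] : H !=set0 by apply/set0P/eqP => H0; apply: bH; rewrite H0; exact: small0.
  apply: bH; apply: card_le_small (sA (f x) _); last by case: (fA x).
  apply: (card_le_inj (f := h)) => [y Hy|y z _ _ /hi//].
  have -> : f x = f y; last by case: (fA y).
  have [<-//|/lt_total[xy|yx]] := EM (x = y).
    by have /asboolP := cH _ _ Hx Hy xy.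
  by have /asboolP := cH _ _ Hy Hx yx.
apply: bH; apply: card_le_small sI; apply: (card_le_inj (f := f)) => [y _|y z Hy Hz fyz].
  by case: (fA y).
apply: contrapT => /lt_total[] yz.
  by have := cH _ _ Hy Hz yz; rewrite fyz => /asboolP.
by have := cH _ _ Hz Hy yz; rewrite fyz => /asboolP.
Qed.

Lemma smallU {T} (A B : set T) : small A -> small B -> small (A `|` B).
Proof.
move=> sA sB; apply: sub_small (_ : _ `<=` \bigcup_(b in [set: bool]) (if b then A else B)) _.
  by move=> x [] ?; [exists true|exists false].
by apply: small_bigcup => [|[]//]; apply: countable_small.
Qed.

Lemma small_setX {T U} (A : set T) (B : set U) : small A -> small B -> small (A `*` B).
Proof.
move=> sA sB; apply: sub_small (_ : _ `<=` \bigcup_(x in A) (pair x @` B)) _.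
  by move=> [x y] [/= Ax By]; exists x => //; exists y.
by apply: small_bigcup => // x _; exact: image_small.
Qed.

Lemma small_below a : small (below le a).
Proof. by case: hK => -[_ /(_ a)[_]] /negP. Qed.

Lemma small_seg a : small [set x | le x a].
Proof.
apply: sub_small (_ : _ `<=` below le a `|` [set a]) _.
  by move=> x /le_eqVlt[->|]; [right|left].
by apply: smallU; [exact: small_below|exact: small1].
Qed.

Lemma unbounded (H : set K) : ~ small H -> forall a, exists2 x, H x & a ≺ x.
Proof.
move=> bH a; apply: contrapT => nH; apply: bH; apply: (sub_small _ (small_seg a)) => x Hx /=.
by apply/leNgt => ax; apply: nH; exists x.
Qed.

Lemma bounded {J} (I : set J) (f : J -> K) : small I -> exists b, forall i, I i -> f i ≺ b.
Proof.
move=> sI; have : small (\bigcup_(i in I) [set x | le x (f i)]).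
  by apply: small_bigcup => // i _; exact: small_seg.
move=> s; apply: contrapT => nb; apply: big_setT; apply: (sub_small _ s) => x _.
apply: contrapT => nx; apply: nb; exists x => i Ii.
by apply/ltNge => xi; apply: nx; exists i.
Qed.

Lemma exists_gt a : exists x, a ≺ x.
Proof. by have [x _ ax] := unbounded big_setT a; exists x. Qed.

(** * Tails of subsets of kappa *)

Definition ev (H E : set K) := exists b, forall x, H x -> b ≺ x -> E x.

Lemma evT (H E : set K) : (forall x, H x -> E x) -> ev H E.
Proof. by move=> HE; have [k] := inhK; exists k => x /HE. Qed.

Lemma ev_gt H a : ev H [set x | a ≺ x].
Proof. by exists a. Qed.

Lemma sub_ev (H E E' : set K) : ev H E -> (forall x, H x -> E x -> E' x) -> ev H E'.
Proof. by move=> [b bE] EE'; exists b => x Hx bx; apply: EE' (bE _ _ _). Qed.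

Lemma ev_sub (H H' E : set K) : H' `<=` H -> ev H E -> ev H' E.
Proof. by move=> HH [b bE]; exists b => x /HH; exact: bE. Qed.

Lemma ev_all {J} (H : set K) (I : set J) (E : J -> set K) : small I ->
  (forall i, I i -> ev H (E i)) -> ev H [set x | forall i, I i -> E i x].
Proof.
move=> sI Ei; have [k0] := inhK.
have /choice[f fE] i : exists b, I i -> forall x, H x -> b ≺ x -> E i x.
  by case: (EM (I i)) => [/Ei[b]|]; [exists b|exists k0].
have [b bf] := bounded f sI.
by exists b => x Hx bx i Ii; apply: (fE i) => //; apply: lt_trans bx; exact: bf.
Qed.

Lemma evI H (E E' : set K) : ev H E -> ev H E' -> ev H (E `&` E').
Proof.
move=> eE eE'; have : ev H [set x | forall b : bool, setT b -> (if b then E else E') x].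
  by apply: ev_all => [|[]//]; exact: countable_small.
by move=> e; apply: (sub_ev e) => x _ Ex; split; [exact: (Ex true)|exact: (Ex false)].
Qed.

Lemma ev_ex H E : ~ small H -> ev H E -> exists2 x, H x & E x.
Proof. by move=> /unbounded bH [b bE]; have [x Hx bx] := bH b; exists x => //; exact: bE. Qed.

(* [h x] is an element of least rank not among the [h y], y < x. *)
Lemma enumerate {T} (B : set T) (rk : T -> K) :
  (forall b, small [set p | B p /\ le (rk p) b]) -> B #<= [set: K].
Proof.
move=> sB.
pose avail x (h : K -> option T) p := B p /\ forall y, y ≺ x -> h y <> Some p.
pose best x h p := avail x h p /\ forall q, avail x h q -> le (rk p) (rk q).
have best_ext x f g : (forall y, y ≺ x -> f y = g y) -> best x f = best x g.
  move=> fg; have av p : avail x f p <-> avail x g p.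
    by split=> -[Bp np]; split=> // y yx; [rewrite -fg//|rewrite fg//]; exact: np.
  apply/predeqP => p; split=> -[/av ap pmin]; split=> // q /av; exact: pmin.
have [h hE] : exists h : K -> option T, forall x,
    h x = if pselect (exists p, best x h p) is left e then Some (sval (cid e)) else None.
  apply: (wf_rec None) => x f g fg; have E := best_ext _ _ _ fg.
  by rewrite E.
have hSome x p : avail x h p -> exists2 q, h x = Some q & best x h q.
  move=> ap; have [_ [q aq <-] qmin] : exists2 z, [set rk q | q in avail x h] z &
      forall y, [set rk q | q in avail x h] y -> le z y.
    by apply: exists_min; exists (rk p), p.
  rewrite hE; case: pselect => [e|[]]; last first.
    by exists q; split=> // t at_; apply: qmin; exists t.
  by exists (sval (cid e)) => //; case: (cid e).
suff hS p : B p -> exists x, h x = Some p.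
  rewrite -(card_le_eql (card_some (A := B))).
  by apply: (card_le_surj (f := h)) => _ [p /hS[x <-] <-]; exists x.
(* An element [p] that is never listed stays available, so every stage lists an element of rank at
   most [rk p]: kappa many distinct ones, against [sB]. *)
move=> Bp; apply: contrapT => np.
have ap x : avail x h p by split=> // y _ hy; apply: np; exists y.
have /choice[q qP] x : exists q, h x = Some q /\ best x h q.
  by have [q] := hSome _ _ (ap x); exists q.
have : ~ small [set q | B q /\ le (rk q) (rk p)]; last exact.
apply/bigP; exists q => [x|x y qxy].
  by have [_ [[Bq _] /(_ _ (ap x))]] := qP x.
apply: contrapT => /lt_total[] xy.
  by have [_ [[_ /(_ _ xy) nq] _]] := qP y; apply: nq; rewrite -qxy; case: (qP x).
by have [_ [[_ /(_ _ xy) nq] _]] := qP x; apply: nq; rewrite qxy; case: (qP y).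
Qed.

(** Recovers the half of [card_lt] that [small] leaves out: with constant rank the enumeration
    exhausts a small set. *)
Lemma small_le {T} (A : set T) : small A -> A #<= [set: K].
Proof.
move=> sA; have [k0] := inhK; apply: (enumerate (rk := fun=> k0)) => b.
by apply: (sub_small _ sA) => x [].
Qed.

Lemma small_card_lt {T} (A : set T) : small A <-> card_lt A [set: K].
Proof. by split=> [sA|[_ /negP]//]; split; [exact: small_le|exact/negP]. Qed.

Lemma le_bigcup {J T} (I : set J) (A : J -> set T) : I #<= [set: K] ->
  (forall i, I i -> small (A i)) -> \bigcup_(i in I) A i #<= [set: K].
Proof.
move=> IK sA; have [k0] := inhK; have [c _ ci] := card_le_fun k0 IK.
pose in_by p x := exists i, [/\ I i, A i p & c i = x].
have /choice[rk rkP] p : exists x, (\bigcup_(i in I) A i) p -> in_by p x.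
  case: (EM ((\bigcup_(i in I) A i) p)) => [[i Ii Ap]|]; last by exists k0.
  by exists (c i) => _; exists i.
apply: (enumerate (rk := rk)) => b.
apply: (@sub_small _ _ (\bigcup_(i in [set i | I i /\ le (c i) b]) A i)).
  by move=> p [/rkP[i [Ii Ap <-]] rb]; exists i.
apply: small_bigcup => [|i []]; last by move=> + _; exact: sA.
apply: card_le_small (small_seg b); apply: (card_le_inj (f := c)) => [i []//|i j [Ii _] [Ij _]].
exact: ci.
Qed.

Lemma le_setX {T U} (A : set T) (B : set U) :
  A #<= [set: K] -> B #<= [set: K] -> A `*` B #<= [set: K].
Proof.
move=> AK BK; have [k0] := inhK.
have [f _ fi] := card_le_fun k0 AK; have [g _ gi] := card_le_fun k0 BK.
pose rk p := if pselect (le (f p.1) (g p.2)) then g p.2 else f p.1.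
apply: (enumerate (rk := rk)) => b.
apply: (@card_le_small _ _ _ ([set x | le x b] `*` [set x | le x b])); last first.
  by apply: small_setX; exact: small_seg.
apply: (card_le_inj (f := fun p => (f p.1, g p.2))) => [[x y]|[x y] [x' y']] /=.
  move=> [_]; rewrite /rk /=; case: pselect => /= [l lb|/ltNge/ltW l lb]; split=> //=.
    exact: le_trans l lb.
  exact: le_trans l lb.
by move=> [[/= Ax By] _] [[/= Ax' By'] _] [/(fi _ _ Ax Ax') -> /(gi _ _ By By') ->].
Qed.

Lemma le_seq {T} : [set: T] #<= [set: K] -> [set: seq T] #<= [set: K].
Proof.
move=> TK; have [k0] := inhK; have [f _ fi] := card_le_fun k0 TK.
pose inseg b := all (fun x => le (f x) b).
(* The rank bounds the codes of all entries, so there are few sequences of rank at most [b] for each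
   of the countably many lengths. *)
have /choice[rk rkP] l : exists b, inseg b l.
  elim: l => [|x l [b lb]]; first by exists k0.
  exists (if pselect (le (f x) b) then b else f x).
  case: pselect => /= [xb|/ltNge/ltW bx]; first by rewrite xb.
  rewrite lexx /=; elim: l lb => //= y l IH /andP[yb lb].
  by rewrite (le_trans yb bx) IH.
apply: (enumerate (rk := rk)) => b.
apply: (@sub_small _ _ (\bigcup_(n in [set: nat]) [set l | inseg b l /\ size l = n])).
  move=> l [_ lb]; exists (size l) => //; split=> //; have := rkP l; rewrite /inseg.
  elim: l {lb} (rk l) lb => //= x l IH m mb /andP[xm lm].
  by rewrite (le_trans xm mb) (IH _ mb).
apply: small_bigcup => [|n _]; first exact: countable_small.
elim: n => [|n IH].
  by apply: (sub_small _ (small1 [::])) => l [_ /size0nil].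
apply: (@sub_small _ _ ((fun p => p.1 :: p.2) @`
    ([set x | le (f x) b] `*` [set l | inseg b l /\ size l = n]))).
  move=> [|x l] [] //= /andP[xb lb] [ln]; by exists (x, l).
apply: image_small; apply: small_setX => //.
apply: card_le_small (small_seg b); apply: (card_le_inj (f := f)) => // x y _ _.
exact: fi.
Qed.

(* Sierpinski's colouring: the rows [D _ x], x in a homogeneous set, are
   lexicographically monotone, so each of their entries stabilises. *)
Lemma decide_seq (D : K -> K -> bool) : exists2 H : set K, ~ small H &
  forall j, exists b, ev H [set x | D j x = b].
Proof.
pose c x y := `[< exists j, [/\ forall i, i ≺ j -> D i x = D i y, ~~ D j x & D j y] >].
have [H bH [b cH]] := homogeneous c; exists H => //.
(* Along [H] the rows move in one lexicographic direction, given by the colour [b]: while the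
   earlier entries agree, an entry equal to [b] stays so. *)
have mono x y j : H x -> H y -> x ≺ y -> (forall i, i ≺ j -> D i x = D i y) ->
    D j x = b -> D j y = b.
  move=> Hx Hy xy eqD Dx; move: (cH _ _ Hx Hy xy); rewrite /c; case: b {cH} Dx => Dx.
    move=> /asboolP[i [eqDi nDx Dy]]; have [ij|/ltNge ji] := EM (le i j); last first.
      by rewrite -(eqDi _ ji).
    have [<-//|/eqD E] := le_eqVlt ij; by rewrite E Dy in nDx.
  move=> /asboolP n; apply/negbTE/negP => Dy; apply: n; exists j; split=> //.
  by rewrite Dx.
(* By induction the entries before [j] agree past a common bound; from there on entry [j] can change
   only once, to [b]. *)
have agree j : exists bd, forall x y, H x -> H y -> bd ≺ x -> bd ≺ y -> D j x = D j y.
  elim/(well_founded_ind lt_wf): j => j IH.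
  have /choice[f fP] i : exists bd, i ≺ j ->
      forall x y, H x -> H y -> bd ≺ x -> bd ≺ y -> D i x = D i y.
    by case: (EM (i ≺ j)) => [/IH[bd]|]; [exists bd|exists j].
  have [bd bdP] := bounded f (small_below j).
  have mono' x y : H x -> H y -> bd ≺ x -> x ≺ y -> D j x = b -> D j y = b.
    move=> Hx Hy bx xy; apply: mono => // i ij.
    by apply: (fP _ ij) => //; do ?[apply: lt_trans xy]; apply: lt_trans bx; exact: bdP.
  case: (EM (exists2 x, H x /\ bd ≺ x & D j x = b)) => [[x [Hx bx] Dx]|nx].
    by exists x => y z Hy Hz xy xz; rewrite (mono' x y)// (mono' x z).
  exists bd => y z Hy Hz bdy bdz; have nb t : H t -> bd ≺ t -> D j t = ~~ b.
    by move=> Ht bt; apply/eqP; apply/negPn/negP => /negP n; apply: nx; exists t => //;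
      case: (D j t) (b) n => [] [].
  by rewrite (nb y)// (nb z).
move=> j; have [bd bdP] := agree j; have [x Hx bx] := unbounded bH bd.
by exists (D j x), bd => y Hy bdy; apply: bdP.
Qed.

Lemma decide {J} (I : set J) (D : J -> K -> bool) : I #<= [set: K] ->
  exists2 H : set K, ~ small H & forall j, I j -> exists b, ev H [set x | D j x = b].
Proof.
move=> IK; have [k0] := inhK; have [c _ ci] := card_le_fun k0 IK.
have [H bH HP] := decide_seq (fun k x => `[< exists j, [/\ I j, c j = k & D j x] >]).
exists H => // j Ij; have [b eb] := HP (c j); exists b; apply: (sub_ev eb) => x _ /= <-.
apply/idP/asboolP => [Dx|[i [Ii /(ci _ _ Ii Ij) ->]]//].
by exists j.
Qed.

(** kappa is a strong limit: given kappa many distinct subsets, decide the membership of every [t]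
    in [A] along one [H]. As [A] is small, past a single bound all the subsets coincide. *)
Lemma small_powerset {T} (A : set T) : small A -> small [set X | X `<=` A].
Proof.
move=> sA; apply: contrapT => /bigP[h hA hi].
have [H bH HP] := decide (fun t x => `[< h x t >]) (small_le sA).
have /choice[b bP] t : exists b, A t -> ev H [set x | `[< h x t >] = b].
  by case: (EM (A t)) => [/HP[b]|]; [exists b|exists true].
have [bd bdP] := ev_all sA bP.
have [x Hx bx] := unbounded bH bd; have [y Hy xy] := unbounded bH x.
suff /hi E : h x = h y by rewrite E in xy; exact: ltxx xy.
apply/predeqP => t; have [At|nAt] := EM (A t).
  have by_ : bd ≺ y := lt_trans bx xy.
  have E : `[< h x t >] = `[< h y t >].
    by rewrite (bdP _ Hx bx _ At); apply/esym; exact: (bdP _ Hy by_ _ At).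
  by split=> /asboolP; [rewrite E|rewrite -E] => /asboolP.
by split=> /hA /nAt.
Qed.

(** * Regressive functions and large sets *)

Definition regressive (g : K -> K) := ev [set: K] [set x | g x ≺ x].

(* Let [H] decide the functions [f w] obtained by composing the [g j]. Among those
   not eventually constant on [H] take [f w] minimal modulo the tail filter of [H]:
   as [g j \o f w] is below [f w], it is eventually constant, so the image of [H]
   under [f w] is as required. *)
Lemma stabilise {J} (I : set J) (g : J -> K -> K) : I #<= [set: K] ->
  (forall j, I j -> regressive (g j)) ->
  exists2 H : set K, ~ small H & forall j, I j -> exists c, ev H [set x | g j x = c].
Proof.
move=> IK gr; pose JI := {j | I j}.
pose f := foldr (fun (j : JI) (u : K -> K) => g (sval j) \o u) id.
have wK : [set: seq JI * K] #<= [set: K].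
  apply: card_le_trans (_ : [set: seq JI] `*` [set: K] #<= _); first exact: subset_card_le.
  apply: le_setX => //; apply: le_seq; apply: card_le_trans IK.
  by apply: (card_le_inj (f := sval)) => [[]//|[x p] [y q] _ _ /= xy]; exact: eq_exist.
have [H bH HP] := decide (fun p x => `[< f p.1 x = p.2 >]) wK.
pose cst w := exists c, ev H [set x | f w x = c].
have ncst0 : ~ cst [::].
  move=> [c [b cP]]; have [x Hx bx] := unbounded bH b; have [y Hy xy] := unbounded bH x.
  by move: (xy); rewrite [x](cP _ Hx bx) -(cP _ Hy (lt_trans bx xy)) => /ltxx.
have [w ncw wmin] : exists2 w, ~ cst w & forall v, ~ cst v -> ~ ev H [set x | f v x ≺ f w x].
  apply: contrapT => nw.
  (* Otherwise iterating [nx] gives compositions that descend on tails; countably many tails have a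
     common point [x], where the values descend forever. *)
  have /choice[nx nxP] w : exists v, ~ cst w -> ~ cst v /\ ev H [set x | f v x ≺ f w x].
    case: (EM (cst w)) => [|cw]; first by exists w.
    apply: contrapT => nv; apply: nw; exists w => // v cv vw; apply: nv; by exists v.
  pose s n := iter n nx [::].
  have cs n : ~ cst (s n) by elim: n => //= n /nxP[].
  have [] := ev_ex bH (ev_all (H := H) (I := [set: nat])
    (E := fun n => [set x | f (s n.+1) x ≺ f (s n) x]) _ _).
  - exact: countable_small.
  - by move=> n _; case: (nxP _ (cs n)).
  move=> x Hx xP; have [_ [n _ <-] nmin] : exists2 z, range (fun n => f (s n) x) z &
      forall y, range (fun n => f (s n) x) y -> le z y.
    by apply: exists_min; exists (f (s 0%N) x), 0%N.
  by have /ltNge := xP n Logic.I; apply; apply: nmin; exists n.+1.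
(* As [f w] is not eventually constant and each equation is decided, every single value is
   eventually avoided, hence so are all values up to [c]. *)
have wlim c : ev H [set x | c ≺ f w x].
  have : ev H [set x | forall c', [set c' | le c' c] c' -> f w x <> c'].
    apply: ev_all => [|c' _]; first exact: small_seg.
    have [[] eb] := HP (w, c') Logic.I; last by apply: (sub_ev eb) => x _ /asboolP.
    by case: ncw; exists c'; apply: (sub_ev eb) => x _ /asboolP.
  by move=> e; apply: (sub_ev e) => x _ n; apply/ltNge => l; exact: (n _ l).
exists (f w @` H).
  move=> /(bounded id)[b bP]; have [x Hx /= bx] := ev_ex bH (wlim b).
  by apply: (@ltxx b); apply: (lt_trans bx); apply: bP; exists x.
move=> j Ij; have [b bP] := gr j Ij.
have [c [b1 cP]] : cst (exist _ j Ij :: w).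
  apply: contrapT => /wmin; apply; apply: (sub_ev (wlim b)) => x _ bx.
  exact: bP.
(* A point of the image above [b2] comes from a point of [H] above [b1]. *)
have [b2 b2P] := bounded (f w) (small_seg b1).
exists c, b2 => _ [x Hx <-] bx; apply: cP => //; apply/ltNge => xb.
exact/(ltxx (x := b2))/(lt_trans bx)/b2P.
Qed.

(* The tail filter of [H] plays the role of a normal ultrafilter on an algebra of
   kappa many sets. *)
Definition large (E : set K) := exists2 g : K -> K -> K, forall j, regressive (g j) &
  forall H, ~ small H -> (forall j, exists c, ev H [set x | g j x = c]) -> ev H E.

Lemma large_stabilised {J} (I : set J) (g : J -> K -> K) (E : set K) :
  I #<= [set: K] -> (forall j, I j -> regressive (g j)) ->
  (forall H, ~ small H -> (forall j, I j -> exists c, ev H [set x | g j x = c]) -> ev H E) ->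
  large E.
Proof.
move=> IK gr gE; have [k0] := inhK; have [c _ ci] := card_le_fun k0 IK.
pose G k x := if pselect (exists j, I j /\ c j = k) is left e then g (sval (cid e)) x else k0.
have Gc j x : I j -> G (c j) x = g j x.
  move=> Ij; rewrite /G; case: pselect => [e|[]]; last by exists j.
  by case: (cid e) => i [Ii /= /(ci _ _ Ii Ij) ->].
exists G => [k|H bH HG].
  have [[j [Ij <-]]|nk] := EM (exists j, I j /\ c j = k).
    by apply: (sub_ev (gr j Ij)) => x _; rewrite /= Gc.
  by exists k0 => x _; rewrite /= /G; case: pselect.
apply: gE => // j Ij; have [t tP] := HG (c j); exists t.
by apply: (sub_ev tP) => x _; rewrite /= Gc.
Qed.

Lemma largeS (E E' : set K) : large E -> E `<=` E' -> large E'.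
Proof.
move=> [g gr gE] EE'; exists g => // H bH HP.
by apply: (sub_ev (gE H bH HP)) => x _ /EE'.
Qed.

Lemma largeI (E E' : set K) : large E -> large E' -> large (E `&` E').
Proof.
move=> [g gr gE] [g' gr' gE'].
apply: (@large_stabilised _ ([set: bool] `*` [set: K])
  (fun p => if p.1 then g p.2 else g' p.2)) => [|[[] j] _|H bH HP].
- by apply: le_setX => //; apply: small_le; exact: countable_small.
- exact: gr.
- exact: gr'.
apply: evI; first by apply: gE => // j; exact: (HP (true, j)).
by apply: gE' => // j; exact: (HP (false, j)).
Qed.

Lemma large_gt a : large [set x | a ≺ x].
Proof. by exists (fun _ _ => a) => [_|H _ _]; [exact: ev_gt|exact: ev_gt]. Qed.

Lemma large_ex (E : set K) : large E -> exists x, E x.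
Proof.
move=> [g gr gE].
have [H bH HP] := stabilise (g := g) (I := [set: K]) (card_lexx _) (fun j _ => gr j).
by have [|x _ Ex] := ev_ex bH (gE H bH _); [move=> j; exact: HP|exists x].
Qed.

(** Choosing a counterexample below [x] is regressive. If the choice stabilises at [c] on [H], no
    late [x] in [H] above [f c] has a counterexample. *)
Lemma large_closed (f : K -> K) : large [set x | forall y, y ≺ x -> f y ≺ x].
Proof.
have [k0] := inhK.
pose g x := if pselect (exists y, y ≺ x /\ ~ f y ≺ x) is left e then sval (cid e) else k0.
apply: (@large_stabilised _ [set: unit] (fun=> g)) => [|_ _|H bH /(_ tt I)[c [b cP]]].
- by apply: small_le; exact: countable_small.
- exists k0 => x _ kx; rewrite /= /g; case: pselect => // e.
  by case: (cid e) => y [].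
apply: (sub_ev (E := [set x | b ≺ x /\ f c ≺ x])) => [|x Hx [bx cx] y yx].
  by apply: evI; exact: ev_gt.
apply: contrapT => ny; have := cP _ Hx bx; rewrite /= /g; case: pselect => [e|[]]; last by exists y.
by case: (cid e) => z /= [zx nz] zc; apply: nz; rewrite zc.
Qed.

(** Stabilisation for functions with values in any set ranked with few values up to each rank. Once
    the rank is constant, avoiding each of the few candidates on a tail would avoid them all. *)
Lemma large_stable {J T} (I : set J) (V : set T) (rk : T -> K) (F : J -> K -> T) (E : set K) :
  I #<= [set: K] -> (forall b, small [set t | V t /\ le (rk t) b]) ->
  (forall j, I j -> ev [set: K] [set x | V (F j x) /\ rk (F j x) ≺ x]) ->
  (forall H, ~ small H -> (forall j, I j -> exists2 t, V t & ev H [set x | F j x = t]) -> ev H E) ->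
  large E.
Proof.
move=> IK sV Fr FE; have [k0] := inhK; have [k1 k01] := exists_gt k0.
pose V' := some @` V `|` [set None].
(* [None] tracks the rank; [Some t] tracks whether the value is [t], with [k1] for true and [k0] for
   false. *)
pose g p x := if p.2 is Some t then if pselect (F p.1 x = t) then k1 else k0 else rk (F p.1 x).
have VK : V' #<= [set: K].
  apply: (enumerate (rk := oapp rk k0)) => b.
  apply: (@sub_small _ _ (some @` [set t | V t /\ le (rk t) b] `|` [set None])).
    by move=> _ [[[t Vt <-]|->]] /= tb; [left; exists t|right].
  by apply: smallU (small1 _); exact: image_small.
apply: (@large_stabilised _ (I `*` V') g) => [|[j [t|]] [/= Ij _]|H bH HP].
- exact: le_setX.
- exists k1 => x _ kx; rewrite /g /=; case: pselect => /= _ //; exact: lt_trans k01 kx.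
- by apply: (sub_ev (Fr j Ij)) => x _ [].
apply: FE => // j Ij; have [c cP] : exists c, ev H [set x | rk (F j x) = c].
  by apply: (HP (j, None)); split=> //; right.
apply: contrapT => nt.
have : ev H [set x | forall t, [set t | V t /\ le (rk t) c] t -> F j x <> t].
  apply: ev_all => [|t [Vt _]]; first exact: sV.
  have [|c' c'P] := HP (j, Some t); first by split=> //=; left; exists t.
  rewrite /g /= in c'P; have [E0|n0] := EM (c' = k1); last first.
    by apply: (sub_ev c'P) => x _ /=; case: pselect => //= _ /esym.
  case: nt; exists t => //; apply: (sub_ev c'P) => x _ /=; case: pselect => //= _ E1.
  by move: k01; rewrite E1 E0 => /ltxx.
move=> /evI/(_ (evI cP (ev_sub (@subsetT _ H) (Fr j Ij))))/(ev_ex bH)[x _ [nF [/= rc [VF _]]]].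
by apply: (nF (F j x)) => //; split=> //; rewrite rc lexx.
Qed.

Lemma ev_contra (H E : set K) :
  (forall H', H' `<=` H -> (forall x, H' x -> ~ E x) -> small H') -> ev H E.
Proof.
move=> /(_ (H `\` E)) sHE; have [| |b bP] := bounded id (sHE _ _).
- by move=> x [].
- by move=> x [].
by exists b => x Hx bx; apply: contrapT => nE; apply: (ltxx (lt_trans bx (bP x _))).
Qed.

End WeaklyCompact.

(** * Antichains and regular suborders *)

Section Antichains.
Context {d : Order.disp_t} {P : porderType d}.
Implicit Types (A Q R X : set P) (p q : P).

Lemma compatible_refl Q p : Q p -> compatible Q p p.
Proof. by exists p; split; rewrite // Order.POrderTheory.lexx. Qed.

Lemma compatible_sym Q p q : compatible Q p q -> compatible Q q p.
Proof. by move=> [r [Qr rp rq]]; exists r. Qed.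

Lemma sub_compatible Q R p q : R `<=` Q -> compatible R p q -> compatible Q p q.
Proof. by move=> RQ [r [/RQ Qr rp rq]]; exists r. Qed.

(** Maximality as predensity: an element incompatible with all of [A] could be added. *)
Lemma maximal_antichainP Q A : maximal_antichain Q A <->
  antichain Q A /\ forall q, Q q -> exists2 a, A a & compatible Q q a.
Proof.
split=> -[aA maxA]; split=> //.
  move=> q Qq; apply: contrapT => nA.
  have nq a : A a -> ~ compatible Q q a by move=> Aa qa; apply: nA; exists a.
  suff E : q |` A = A by apply: (nq q _ (compatible_refl Qq)); rewrite -E; left.
  apply: maxA; last by move=> x; right.
  split=> [x [->//|/aA.1//]|x y [->|Ax] [->|Ay] xy //].
  - exact: nq.
  - by move=> /compatible_sym; exact: nq.
  - exact: aA.2.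
move=> B aB AB; apply/seteqP; split=> // b Bb.
have [a Aa ba] := maxA b (aB.1 _ Bb); have [->//|nab] := EM (b = a).
by case: (aB.2 _ _ Bb (AB _ Aa) nab).
Qed.

Lemma maximal_antichain_ex Q A : antichain Q A ->
  exists2 B, maximal_antichain Q B & A `<=` B.
Proof.
(* Zorn's lemma is applied to the sets that can be added to [A], so that the empty chain is
   covered. *)
move=> aA; have [|X [aX maxX]] := @Zorn_bigcup _ [set X | antichain Q (A `|` X)].
  move=> F FP Ftot; split=> [p [/aA.1//|[X FX Xp]]|p q].
    by apply: (FP _ FX).1; right.
  move=> [Ap|[X FX Xp]] [Aq|[Y FY Yq]].
  - exact: aA.2.
  - by apply: (FP _ FY).2; [left|right].
  - by apply: (FP _ FX).2; [right|left].
  - have [XY|YX] := Ftot _ _ FX FY.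
      by apply: (FP _ FY).2; right=> //; exact: XY.
    by apply: (FP _ FX).2; right=> //; exact: YX.
exists (A `|` X); last by move=> x; left.
split=> // B aB AXB; apply/seteqP; split=> // b Bb; apply: contrapT => nb.
have AB : A `|` (X `|` B) = B.
  by rewrite setUA; apply/seteqP; split=> [x [/AXB//|//]|x Bx]; right.
apply: (maxX (X `|` B)); last by rewrite /= AB.
split=> [x|XB]; first by left.
by apply: nb; right; apply: XB; right.
Qed.

End Antichains.

(** * Chain condition, Knaster property, stationary layering *)

Section Posets.
Context {K : Type} {le : rel K} (hK : weakly_compact le).
Context {d : Order.disp_t} {P : porderType d}.

Local Notation "x ≺ y" := (below le y x) (at level 70, no associativity).
Local Notation small := (@small K _).
Local Notation comp := (compatible [set: P]).



(** Colour pairs by compatibility; the incompatible colour would give an antichain of size kappa. *)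
Lemma chain_condition_Knaster : chain_condition P K -> Knaster P K.
Proof.
move=> cc A; rewrite card_eq_le => /andP[AK KA].
have [h hA hi] : exists2 h : K -> P, forall k, A (h k) & injective h.
  by apply/(bigP hK)/negP/negPn.
have [H /negP/negPn bH [[] cH]] := homogeneous hK (fun x y => `[< comp (h x) (h y) >]).
  exists (h @` H); split.
  - by move=> _ [x _ <-]; exact: hA.
  - rewrite card_eq_le; apply/andP; split.
      apply: card_le_trans AK; apply: subset_card_le => _ [x _ <-]; exact: hA.
    by apply: card_le_trans bH _; apply: (card_le_inj (f := h)) => [x Hx|x y _ _ /hi//]; exists x.
  move=> _ _ [x Hx <-] [y Hy <-]; have [->|] := EM (x = y); first exact: compatible_refl.
  move=> /(lt_total hK)[] xy; first by have /asboolP := cH _ _ Hx Hy xy.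
  by have /asboolP/compatible_sym := cH _ _ Hy Hx xy.
have [|_] := cc (h @` H); last case.
  split=> // _ _ [x Hx <-] [y Hy <-] hxy.
  have nxy : x <> y by move=> E; rewrite E in hxy.
  have [xy|xy] := lt_total hK nxy.
    by have /asboolP := cH _ _ Hx Hy xy.
  by move=> /compatible_sym; have /asboolP := cH _ _ Hy Hx xy.
by apply: card_le_trans bH _; apply: (card_le_inj (f := h)) => [x Hx|x y _ _ /hi//]; exists x.
Qed.

Lemma Knaster_chain_condition : Knaster P K -> chain_condition P K.
Proof.
move=> kn A aA; apply/(small_card_lt hK); apply: contrapT => /(bigP hK)[h hA hi].
have [|B [BA BK cB]] := kn (range h).
  by apply: inj_card_eq => x y _ _ /hi.
move: BK; rewrite card_eq_le => /andP[_ /negPn/negP]; apply.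
have [[p Bp]|nB] := EM (exists p, B p).
  apply: (sub_small _ (small1 hK p)) => q Bq; apply: contrapT => pq.
  have BA' t : B t -> A t by move=> /BA[x _ <-].
  by apply: (aA.2 p q (BA' _ Bp) (BA' _ Bq) _ (cB p q Bp Bq)) => E; apply: pq.
by apply: (sub_small _ (small0 hK)) => q Bq; case: nB; exists q.
Qed.

(* One step of closing [T] off; a union of a chain of such steps is regular. *)
Definition reaches (T T' : set P) :=
  (forall p q, T p -> T q -> comp p q -> compatible T' p q) /\
  (forall X, X `<=` T -> (exists p, forall a, X a -> ~ comp p a) ->
     exists2 p, T' p & forall a, X a -> ~ comp p a).

(** As kappa is a strong limit, few subsets of [T] need a witness. *)
Lemma reaches_ex (T : set P) : small T ->
  exists T', [/\ small T', T `<=` T' & reaches T T'].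
Proof.
move=> sT.
have /choice[w wP] (pq : P * P) : exists Y : set P, small Y /\
    (comp pq.1 pq.2 -> compatible Y pq.1 pq.2).
  have [[r [_ rp rq]]|nc] := EM (comp pq.1 pq.2); last by exists set0; split=> //; exact: (small0 hK).
  by exists [set r]; split=> [|_]; [exact: (small1 hK)|exists r].
have /choice[u uP] (X : set P) : exists Y : set P, small Y /\
    ((exists p, forall a, X a -> ~ comp p a) -> exists2 p, Y p & forall a, X a -> ~ comp p a).
  have [[p pX]|nc] := EM (exists p, forall a, X a -> ~ comp p a).
    by exists [set p]; split=> [|_]; [exact: (small1 hK)|exists p].
  by exists set0; split=> //; exact: (small0 hK).
exists (T `|` (\bigcup_(pq in T `*` T) w pq `|` \bigcup_(X in [set X | X `<=` T]) u X)); split.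
- do ![apply: (smallU hK) => //].
    by apply: (small_bigcup hK) => [|pq _]; [exact: (small_setX hK)|case: (wP pq)].
  by apply: (small_bigcup hK) => [|X _]; [exact: (small_powerset hK)|case: (uP X)].
- by move=> x; left.
split=> [p q Tp Tq /((wP (p, q)).2)|X XT /((uP X).2)[p up pX]].
  by apply: sub_compatible => x wx; right; left; exists (p, q).
by exists p => //; right; right; exists X.
Qed.

Lemma sub_reaches (T T' U U' : set P) :
  U `<=` T -> T' `<=` U' -> reaches T T' -> reaches U U'.
Proof.
move=> UT TU [r1 r2]; split=> [p q /UT Tp /UT Tq /(r1 _ _ Tp Tq)|X XU /r2[]].
- exact: sub_compatible.
- exact: subset_trans UT.
- by move=> p /TU; exists p.
Qed.

(** [C] serves to keep the stages in a given club, [B] to put prescribed conditions into the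
    union. *)
Lemma filtration (C : set (set P)) (B : K -> set P) :
  (forall T, small T -> exists Y, [/\ C Y, small Y & T `<=` Y]) -> (forall x, small (B x)) ->
  exists S : K -> set P, [/\ forall x, C (S x), forall x, small (S x), forall x, B x `<=` S x &
    forall x y, x ≺ y -> S x `<=` S y /\ reaches (S x) (S y)].
Proof.
move=> hC sB; have /choice[G GP] (T : set P) : exists Y, small T ->
    [/\ C Y, small Y, T `<=` Y & reaches T Y].
  case: (EM (small T)) => [sT|]; last by exists set0.
  have [T' [sT' TT' rT]] := reaches_ex sT; have [Y [CY sY TY]] := hC _ sT'.
  exists Y => _; split=> //; first exact: subset_trans TY.
  exact: sub_reaches rT.
have [S SE] : exists S : K -> set P, forall x, S x = G (\bigcup_(y in below le x) S y `|` B x).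
  apply: (wf_rec hK set0 (F := fun x S => G (\bigcup_(y in below le x) S y `|` B x))) => x f g fg.
  by congr (G (_ `|` _)); apply: eq_bigcupr => y /fg.
have sS x : small (S x).
  elim/(well_founded_ind (lt_wf hK)): x => x IH; rewrite SE.
  have [|//] := GP (\bigcup_(y in below le x) S y `|` B x); apply: (smallU hK) => //.
  by apply: (small_bigcup hK) => //; exact: (small_below hK).
have sT x : small (\bigcup_(y in below le x) S y `|` B x).
  by apply: (smallU hK) => //; apply: (small_bigcup hK) => //; exact: (small_below hK).
exists S; split=> // [x|x|x y xy].
- by rewrite SE; case: (GP _ (sT x)).
- by rewrite SE; case: (GP _ (sT x)) => _ _ TY _ p Bp; apply: TY; right.
rewrite (SE y); case: (GP _ (sT y)) => _ _ TY rY.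
have ST : S x `<=` \bigcup_(y in below le y) S y `|` B y by move=> p Sp; left; exists x.
by split; [exact: subset_trans TY|exact: sub_reaches rY].
Qed.

Section Filtration.
Context (cc : chain_condition P K) (S : K -> set P) (sS : forall x, small (S x)).
Context (Sr : forall x y, x ≺ y -> S x `<=` S y /\ reaches (S x) (S y)).

Let Q := \bigcup_x S x.

Let S_le x y : le x y -> S x `<=` S y.
Proof. by move=> xy; have [->//|{}xy] := le_eqVlt xy; have [] := Sr xy. Qed.

Lemma filtration_le : Q #<= [set: K].
Proof. exact: (le_bigcup hK). Qed.

(** A maximal antichain of [Q] is small, so it lies in one stage. If some condition of [P] were
    incompatible with all of it, a later stage would contain such a condition. *)
Lemma filtration_regular : regular_suborder [set: P] Q.
Proof.
have com p q : Q p -> Q q -> exists x, S x p /\ S x q.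
  move=> [x _ xp] [y _ yq]; have [xy|yx] := le_total hK x y.
    by exists y; split=> //; exact: (S_le xy).
  by exists x; split=> //; exact: (S_le yx).
have compQ p q : Q p -> Q q -> comp p q -> compatible Q p q.
  move=> Qp Qq pq; have [x [xp xq]] := com _ _ Qp Qq.
  have [y xy] := exists_gt hK x; have [_ [/(_ _ _ xp xq pq) pqy _]] := Sr xy.
  by apply: sub_compatible pqy => r yr; exists y.
split=> // [p q Qp Qq npq /compQ|A /maximal_antichainP[[AQ aA] mA]]; first by move=> /(_ Qp Qq).
have aA' : antichain [set: P] A.
  by split=> // p q Ap Aq pq /compQ; move=> /(_ (AQ _ Ap) (AQ _ Aq)); exact: aA.
apply/maximal_antichainP; split=> // p _; apply: contrapT => np.
have /choice[rk rkP] q : exists x, A q -> S x q.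
  by case: (EM (A q)) => [/AQ[x _ xq]|]; [exists x|have [x] := inhK hK; exists x].
have [b bP] := bounded hK rk ((small_card_lt hK _).2 (cc aA')).
have [c bc] := exists_gt hK b; have [_ [_ /(_ A)[]]] := Sr bc.
- by move=> a Aa; apply: (S_le (ltW (bP _ Aa))); exact: rkP.
- by exists p => a Aa pa; apply: np; exists a.
move=> q cq nq; have [|a Aa qa] := mA q; first by exists c.
by apply: (nq a Aa); exact: sub_compatible qa.
Qed.

(** The continuous version of the chain, whose limit stages are candidates for regular suborders. *)
Let S' x := \bigcup_(y in below le x) S y.

Let rk_ex q : exists x, Q q -> S x q /\ forall y, S y q -> le x y.
Proof.
have [[x _ xq]|nq] := EM (Q q); last by have [x] := inhK hK; exists x.
have [|y yq ymin] := exists_min hK (A := [set y | S y q]); first by exists x.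
by exists y.
Qed.

(* Otherwise take a maximal antichain [X x] of [S' x] that is not maximal in [P].
   Sending q to an element of [X x] compatible with q is regressive; the values at
   which it stabilises form a maximal antichain [Y] of [Q], so [Y] is small and
   maximal in [P], and [Y = X x] for some x. *)
Lemma large_filtration : @large K le [set x | regular_suborder [set: P] (S' x)].
Proof.
have /choice[sc scP] := exists_gt hK; have [k0] := inhK hK.
have /choice[rk rkP] := rk_ex.
pose limit x := forall y, y ≺ x -> sc y ≺ x.
have S'Q x : S' x `<=` Q by move=> q [y _ yq]; exists y.
have rkS' x q : Q q -> S' x q <-> rk q ≺ x.
  move=> Qq; have [rq rmin] := rkP q Qq; split=> [[y yx /rmin]|rx]; last by exists (rk q).
  by move=> ry; exact: (le_lt_trans hK) ry yx.
have compS' x p q : limit x -> S' x p -> S' x q -> comp p q -> compatible (S' x) p q.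
  move=> lx [y yx yp] [z zx zq] pq.
  have [t [tx tp tq]] : exists t, [/\ t ≺ x, S t p & S t q].
    have [yz|zy] := le_total hK y z.
      by exists z; split=> //; exact: (S_le yz).
    by exists y; split=> //; exact: (S_le zy).
  have [_ [/(_ _ _ tp tq pq) c _]] := Sr (scP t).
  by apply: sub_compatible c => r tr; exists (sc t) => //; exact: lx.
pose bad x X := [/\ limit x, maximal_antichain (S' x) X & ~ maximal_antichain [set: P] X].
suff : @large K le [set x | limit x -> forall X, ~ bad x X].
  move=> /(largeI hK)/(_ (large_closed hK sc)); move=> /largeS; apply => x [+ lx] => /(_ lx) nbad.
  split=> // [p q xp xq npq /(compS' _ _ _ lx xp xq)//|X mX].
  by apply: contrapT => nX; apply: (nbad X).
have /choice[X XP] x : exists X, X `<=` S' x /\ ((exists X, bad x X) -> bad x X).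
  have [[X bX]|nX] := EM (exists X, bad x X); last by exists set0; split=> // y [].
  by exists X; split=> //; case: bX => _ [[]].
have /choice[F FP] (qx : P * K) : exists t : option P,
    if t is Some y then X qx.2 y /\ comp qx.1 y else forall y, X qx.2 y -> ~ comp qx.1 y.
  have [[y Xy]|ny] := EM (exists y, X qx.2 y /\ comp qx.1 y); first by exists (Some y).
  by exists None => y Xy cy; apply: ny; exists y.
pose V := some @` Q `|` [set None].
apply: (large_stable hK (I := Q) (V := V) (rk := oapp rk k0) (F := fun q x => F (q, x))).
- exact: filtration_le.
- move=> b; apply: (@sub_small _ _ _ (some @` S b `|` [set None])).
    move=> _ [[[q Qq <-]|->] /= rb]; last by right.
    by left; exists q => //; apply: (S_le rb); case: (rkP q Qq).
  by apply: (smallU hK); [exact: image_small|exact: (small1 hK)].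
- move=> q Qq; exists k0 => x _ kx; have /= := FP (q, x); case: (F _) => [y [Xy _]|_] /=.
    have /(_ y) Sy := (XP x).1; split; first by left; exists y => //; exact/S'Q/Sy.
    by apply/rkS'; [exact/S'Q/Sy|exact: Sy].
  by split=> //; right.
move=> H bH HP; apply: (ev_contra hK) => H' HH' H'P; apply: contrapT => bH'.
have {H'P} H'P x : H' x -> bad x (X x).
  move=> /H'P nx; apply: (XP x).2; apply: contrapT => nX; apply: nx => _ Y bY.
  by apply: nX; exists Y.
pose Y := [set y | Q y /\ @ev K le H' [set x | X x y]].
have preY q : Q q -> exists2 y, Y y & compatible Q q y.
  move=> Qq; have [t Vt /(ev_sub HH') et] := HP q Qq.
  have [x H'x [/= Ft qx]] := ev_ex hK bH' (evI hK et (ev_gt H' (rk q))).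
  have [lx /maximal_antichainP[aX mX] _] := H'P _ H'x.
  have [|y Xy qy] := mX q; first by apply/rkS'.
  (* [None] is excluded: [q] is in [S' x], where [X x] is maximal. *)
  case: t {Vt} Ft et => [z|] Ft et; last first.
    have /= := FP (q, x); rewrite Ft => /(_ _ Xy) []; exact: sub_compatible qy.
  have /= := FP (q, x); rewrite Ft => -[Xz cz]; have Qz : Q z by apply/S'Q/(XP x).1.
  exists z; last first.
    by apply: sub_compatible (S'Q x) _; apply: compS' => //; [apply/rkS'|exact: (XP x).1].
  split=> //; apply: (sub_ev et) => x' _ /= Fx'.
  by have /= := FP (q, x'); rewrite Fx' => -[].
have mY : maximal_antichain [set: P] Y.
  have [_ _] := filtration_regular; apply; apply/maximal_antichainP; split=> //.
  split=> [y []//|y z [Qy ey] [Qz ez] yz cyz].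
  have [x H'x [/= Xy Xz]] := ev_ex hK bH' (evI hK ey ez).
  have [lx [[_ aX] _] _] := H'P _ H'x; apply: (aX y z) => //.
  by apply: compS' => //; [exact: (XP x).1|exact: (XP x).1|exact: sub_compatible cyz].
have sY : small Y by apply/(small_card_lt hK)/cc; case: mY.
have [x H'x YX] := ev_ex hK bH' (ev_all hK sY (fun y (Yy : Y y) => Yy.2)).
have [lx [[XS aX] _] nX] := H'P _ H'x; apply: nX.
(* [X x] is an antichain of [P] that contains the maximal antichain [Y], hence equals it. *)
rewrite (mY.2 (X x) _ YX)//; split=> // y z Xy Xz yz cyz.
by apply: (aX y z) => //; apply: compS' => //; exact: XS.
Qed.

End Filtration.

(** Build the filtration inside the club [C]; a regular union of an initial part of it is in [C] by
    closure under chains. *)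
Lemma chain_condition_stationary : chain_condition P K -> stationarily_layered P le.
Proof.
move=> cc; split=> [R [_]//|C [CP Ccof Cchain]].
have [||S [CS sS _ Sr]] := @filtration C (fun=> set0).
- move=> T /(small_card_lt hK) sT; have [Y CY TY] := Ccof _ sT.
  by exists Y; split=> //; apply/(small_card_lt hK)/CP.
- by move=> _; exact: (small0 hK).
have [k0] := inhK hK.
have [x [kx rx]] := large_ex hK (largeI hK (large_gt k0) (large_filtration cc sS Sr)).
exists (\bigcup_(y in below le x) S y); split; last first.
  apply: Cchain => [|//|y z _ _ yz]; first by exists k0.
  by have [->//|{}yz] := le_eqVlt yz; have [] := Sr _ _ yz.
by split=> //; apply/(small_card_lt hK)/(small_bigcup hK) => //; exact: (small_below hK).
Qed.

Lemma regular_suborder_ex (X : set P) : chain_condition P K -> X #<= [set: K] ->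
  exists Q, [/\ regular_suborder [set: P] Q, Q #<= [set: K] & X `<=` Q].
Proof.
move=> cc XK; have [k0] := inhK hK; have [c _ ci] := card_le_fun k0 XK.
have [||S [_ sS XS Sr]] := @filtration setT (fun x => [set p | X p /\ c p = x]).
- by move=> T sT; exists T; split.
- move=> x; apply: card_le_small (small1 hK x).
  by apply: (card_le_inj (f := c)) => [p []//|p q [Xp _] [Xq _]]; exact: ci.
exists (\bigcup_x S x); split; first exact: filtration_regular.
  exact: (filtration_le sS).
by move=> p Xp; exists (c p) => //; exact: XS.
Qed.



(** By [F] the trace of [A] is maximal in [R], hence by regularity in [Q], so it is all of [A]. *)
Lemma maximal_antichain_trace (Q R A : set P) (F : P -> P) :
  maximal_antichain Q A -> regular_suborder Q R ->
  (forall p, R p -> [/\ R (F p), A (F p) & compatible Q p (F p)]) -> A `<=` R.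
Proof.
move=> [[AQ aA] mA] [RQ Rc Rm] RF; have [_ mAR] : maximal_antichain Q (A `&` R).
  apply: Rm; apply/maximal_antichainP; split=> [|p Rp].
    split=> [p []//|p q [Ap _] [Aq _] pq cpq].
    by apply: (aA p q) => //; exact: sub_compatible cpq.
  have [RFp AFp cF] := RF p Rp; exists (F p) => //.
  by apply: contrapT => /(Rc _ _ Rp RFp).
by have E := mAR A (conj AQ aA) (@subIsetl _ _ _); move=> p; rewrite E => -[].
Qed.

Lemma stationary_chain_condition : stationarily_layered P le -> chain_condition P K.
Proof.
move=> [_ st] A0 /maximal_antichain_ex[A mA A0A].
have [aA /(_ _ Logic.I) AF] := (maximal_antichainP _ _).1 mA.
have /choice[F FP] p : exists a, A a /\ comp p a by have [a] := AF p; exists a.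
(* A club: closing a small set under [F] takes countably many steps, and kappa is regular and
   uncountable. *)
pose C := [set a : set P | small a /\ forall p, a p -> a (F p)].
have [|R [[rR _] [sR CF]]] := st C.
  split=> [a [sa _]|X /(small_card_lt hK) sX|g X [x gx] CX Xmono].
  - exact/(small_card_lt hK).
  - exists (\bigcup_(n in [set: nat]) (iter n (image^~ F) X)).
      split=> [|p [n _ np]]; last by exists n.+1 => //=; exists p.
      apply: (small_bigcup hK) => [|n _]; first exact: (countable_small hK).
      by elim: n => //= n; exact: image_small.
    by move=> p Xp; exists 0%N.
  - split=> [|p [y gy yp]]; last by exists y => //; exact: (CX y gy).2.
    by apply: (small_bigcup hK) => [|y /CX[]//]; exact: (small_below hK).
have AR : A `<=` R.
  apply: (@maximal_antichain_trace [set: P] R A F) => // p Rp.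
  by have [AFp cF] := FP p; split=> //; exact: CF.
by apply/(small_card_lt hK)/(sub_small _ sR)/(subset_trans A0A).
Qed.

End Posets.

(** * The cumulative hierarchy *)

Lemma Eeq_refl x : Eeq x x.
Proof. by elim: x => A f IH; split=> i; exists i. Qed.

Lemma Eeq_sym x y : Eeq x y -> Eeq y x.
Proof.
elim: x y => A f IH [B g] [fg gf]; split=> [j|i].
  by have [i /IH] := gf j; exists i.
by have [j /IH] := fg i; exists j.
Qed.

Lemma Eeq_trans y x z : Eeq x y -> Eeq y z -> Eeq x z.
Proof.
elim: x y z => A f IH [B g] [C h] [fg gf] [gh hg]; split=> [i|k].
  have [j fgij] := fg i; have [k ghjk] := gh j; exists k; exact: IH fgij ghjk.
have [j ghjk] := hg k; have [i fgij] := gf j; exists i; exact: IH fgij ghjk.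
Qed.

Lemma Eeq_ext x y : (forall z, Emem z x <-> Emem z y) -> Eeq x y.
Proof.
case: x y => A f [B g] xy; split=> [i|j].
  by apply/(xy (f i)).1; exists i; exact: Eeq_refl.
have [i gf] := (xy (g j)).2 (ex_intro _ j (Eeq_refl _)); exists i; exact: Eeq_sym.
Qed.

Lemma Emem_Eeql x y z : Eeq x y -> Emem x z -> Emem y z.
Proof. by case: z => A f xy [i xi]; exists i; apply: Eeq_trans xi; exact: Eeq_sym. Qed.

Lemma Emem_Eeqr x y z : Eeq y z -> Emem x y -> Emem x z.
Proof.
case: y z => A f [B g] [fg _] [i xi]; have [j fgij] := fg i.
by exists j; exact: Eeq_trans fgij.
Qed.

(** Representatives make it possible to count trees up to [Eeq]. *)
Lemma representative_ex : exists rep : Ens -> Ens,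
  (forall x, Eeq x (rep x)) /\ forall x y, Eeq x y -> rep x = rep y.
Proof.
have /choice[r rP] (C : set Ens) : exists y, C !=set0 -> C y.
  have [[y Cy]|nC] := EM (C !=set0); first by exists y.
  by exists (MkEns (fun i : False => match i with end)).
exists (fun x => r (Eeq x)); split=> [x|x y xy].
  by apply: rP; exists x; exact: Eeq_refl.
congr r; apply/predeqP => z; split; last exact: Eeq_trans xy.
exact/Eeq_trans/Eeq_sym.
Qed.

(** * Formulas *)

Lemma fo_sat_Eeq M (X : nat -> set Ens) e e' phi :
  (forall k x y, Eeq x y -> X k x -> X k y) -> (forall n, Eeq (e n) (e' n)) ->
  fo_sat M X e phi -> fo_sat M X e' phi.
Proof.
move=> XE; elim: phi e e' => //= [i j|i j|i k|phi IH1 psi IH2|phi IH] e e' ee'.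
- by move=> /(Emem_Eeqr (ee' j)); exact: Emem_Eeql.
- move=> E; apply: Eeq_trans (ee' j); apply: Eeq_trans E; exact: Eeq_sym.
- exact: XE.
- move=> ef ephi; apply: (IH2 e e' ee'); apply: ef; apply: (IH1 e' e _ ephi) => n.
  exact: Eeq_sym.
- by move=> ef x Mx; apply: IH (ef x Mx) => -[|n] //=; exact: Eeq_refl.
Qed.

Fixpoint class_quantifiers (Phi : pi11) : nat :=
  if Phi is ForallClass Phi' then (class_quantifiers Phi').+1 else 0%N.

Fixpoint matrix (Phi : pi11) : fo :=
  match Phi with Matrix phi => phi | ForallClass Phi' => matrix Phi' end.

(** Merges the class quantifiers into one quantifier over assignments, so that a single assignment
    witnesses failure. *)
Lemma pi11_satP M X e Phi : pi11_sat M X e Phi <->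
  forall Y, (forall k, (k < class_quantifiers Phi)%N -> subclass M (Y k)) ->
    (forall k, Y (class_quantifiers Phi + k)%N = X k) -> fo_sat M Y e (matrix Phi).
Proof.
elim: Phi X => [phi|Phi IH] X /=.
  split=> [phiX Y _ YX|]; last by apply.
  by suff -> : Y = X by []; apply/funext => k; rewrite -YX.
split=> [PhiX Y YM YX|PhiX Z ZM].
  apply/(IH (scons (Y (class_quantifiers Phi)) X)).1.
  - exact/PhiX/YM.
  - by move=> k kn; apply: YM; rewrite ltnS ltnW.
  - by move=> [|k]; rewrite ?addn0 //= -YX addSnnS.
apply/IH => Y YM YX; apply: PhiX => [k|k]; last by rewrite addSnnS YX.
by rewrite ltnS leq_eqVlt => /orP[/eqP ->|/YM//]; have := YX 0%N; rewrite addn0 => ->.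
Qed.

Lemma countable_fo : countable [set: fo].
Proof.
pose fix enc phi : GenTree.tree nat := match phi with
  | FMem i j => GenTree.Node 0 [:: GenTree.Leaf i; GenTree.Leaf j]
  | FEq i j => GenTree.Node 1 [:: GenTree.Leaf i; GenTree.Leaf j]
  | FIn i k => GenTree.Node 2 [:: GenTree.Leaf i; GenTree.Leaf k]
  | FBot => GenTree.Node 3 [::]
  | FImp phi psi => GenTree.Node 4 [:: enc phi; enc psi]
  | FAll phi => GenTree.Node 5 [:: enc phi]
  end.
apply: (card_le_inj (f := pickle \o enc)) => // x y _ _ /= /(pcan_inj pickleK).
elim: x y => [i j|i j|i k||phi IH1 psi IH2|phi IH] [i' j'|i' j'|i' k'||phi' psi'|phi'] //=.
- by case=> -> ->.
- by case=> -> ->.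
- by case=> -> ->.
- by case=> /IH1 -> /IH2 ->.
- by case=> /IH ->.
Qed.

(** * Ranks, sizes of levels and the limit structure *)

Section Hierarchy.
Context {K : smallType} {le : rel K} (hK : weakly_compact le).

Local Notation "x ≺ y" := (below le y x) (at level 70, no associativity).
Local Notation small := (@small K _).
Local Notation V := (Vstage le).
Local Notation Vk := (Vstage le [set: K]).

Lemma Vstage_Eeq D x y : Eeq x y -> V D x -> V D y.
Proof.
elim: x D y => A f IH D [B g] [_ gf] [b Db bf]; exists b => // j.
by have [i fgij] := gf j; exact: IH fgij (bf i).
Qed.

Lemma VstageP D x : V D x <-> exists2 b, D b & forall z, Emem z x -> V (below le b) z.
Proof.
case: x => A f; split=> -[b Db bf]; exists b => //.
  by move=> z [i zi]; apply: Vstage_Eeq (bf i); exact: Eeq_sym.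
by move=> i; apply: bf; exists i; exact: Eeq_refl.
Qed.

Lemma sub_Vstage D D' x : D `<=` D' -> V D x -> V D' x.
Proof. by move=> DD' /VstageP[b /DD' D'b bx]; apply/VstageP; exists b. Qed.

Lemma rank_ex : exists rk : Ens -> K, forall x, Vk x -> forall a, V (below le a) x <-> rk x ≺ a.
Proof.
have /choice[rk rkP] x : exists b, Vk x -> forall a, V (below le a) x <-> b ≺ a.
  have [Vx|nV] := EM (Vk x); last by have [b] := inhK hK; exists b.
  have [|b bx bmin] := exists_min hK (A := [set b | forall z, Emem z x -> V (below le b) z]).
    by have /VstageP[b _ bx] := Vx; exists b.
  exists b => _ a; split=> [/VstageP[c ca cx]|ba]; last by apply/VstageP; exists b.
  exact: (le_lt_trans hK) (bmin _ cx) ca.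
by exists rk.
Qed.

Context (rep : Ens -> Ens) (rep_Eeq : forall x, Eeq x (rep x)).
Context (rep_eq : forall x y, Eeq x y -> rep x = rep y).

Lemma rep_rep x : rep (rep x) = rep x.
Proof. by apply: rep_eq; exact/Eeq_sym/rep_Eeq. Qed.

(** A representative is determined by the representatives that belong to it, and these come from a
    small earlier level; kappa is a strong limit. *)
Lemma small_Vstage b : small [set x | V (below le b) x /\ rep x = x].
Proof.
elim/(well_founded_ind (lt_wf hK)): b => b IH.
apply: (@sub_small _ _ _ (\bigcup_(c in below le b)
    [set x | (forall z, Emem z x -> V (below le c) z) /\ rep x = x])).
  by move=> x [/VstageP[c cb cx] rx]; exists c.
apply: (small_bigcup hK) => [|c cb]; first exact: (small_below hK).
apply: card_le_small (small_powerset hK (IH c cb)).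
pose tr x := [set z | (V (below le c) z /\ rep z = z) /\ Emem z x].
have trE x y : (forall z, Emem z x -> V (below le c) z) -> tr x = tr y ->
    forall z, Emem z x -> Emem z y.
  move=> cx xy z zx; have : tr x (rep z).
    split; last exact: Emem_Eeql zx.
    by rewrite rep_rep; split=> //; apply: Vstage_Eeq (cx _ zx).
  by rewrite xy => -[_]; apply: Emem_Eeql; exact/Eeq_sym/rep_Eeq.
apply: (card_le_inj (f := tr)) => [x _ z []//|x y [cx rx] [cy ry] xy].
rewrite -rx -ry; apply: rep_eq; apply: Eeq_ext => z; split.
  exact: trE xy z.
exact: trE (esym xy) z.
Qed.

Context (rk : Ens -> K) (rkP : forall x, Vk x -> forall a, V (below le a) x <-> rk x ≺ a).

(** Restricting parameters to representatives leaves at most kappa many finite tuples. *)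
Let W := {x | Vk x /\ rep x = x}.

Let small_rank b : small [set w : W | le (rk (sval w)) b].
Proof.
have [c bc] := exists_gt hK b; apply: card_le_small (small_Vstage c).
apply: (card_le_inj (f := sval)) => [[x [Vx rx]] /= xb|[x p] [y q] _ _ /= xy].
  by split=> //; apply/(rkP Vx); exact: (le_lt_trans hK) xb bc.
exact: eq_exist.
Qed.

Let toW x (Vx : Vk x) : W := exist _ (rep x) (conj (Vstage_Eeq (rep_Eeq x) Vx) (rep_rep x)).

Section Los.
Context (X : K -> nat -> set Ens) (XE : forall c k x y, Eeq x y -> X c k x -> X c k y).
Context (a : Ens) (Va : Vk a).

Let env (l : seq W) : nat -> Ens := nth a (map sval l).

(** Skolem functions for counterexamples to [FAll i.1]; [None] records that there is none. *)
Let wit (i : fo * seq W) (c : K) (o : option W) :=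
  if o is Some w
  then V (below le c) (sval w) /\ ~ fo_sat (V (below le c)) (X c) (env (w :: i.2)) i.1
  else forall x, V (below le c) x -> fo_sat (V (below le c)) (X c) (scons x (env i.2)) i.1.

Let env_cons w l : env (w :: l) = scons (sval w) (env l).
Proof. by apply/funext => -[]. Qed.

Let Venv l n : Vk (env l n).
Proof. by rewrite /env; elim: l n => [|[w [Vw rw]] l IH] [|n] /=. Qed.

Let sub_below (b : K) : below le b `<=` [set: K]. Proof. by []. Qed.

Let wit_ex i c : exists o, wit i c o.
Proof.
have [[x [Vx nx]]|nx] := EM (exists x, V (below le c) x /\
    ~ fo_sat (V (below le c)) (X c) (scons x (env i.2)) i.1); last first.
  by exists None => x Vx; apply: contrapT => n; apply: nx; exists x.
exists (Some (toW (sub_Vstage (@sub_below c) Vx))); split=> /=.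
  exact: Vstage_Eeq Vx.
rewrite env_cons => /fo_sat_Eeq n; apply/nx/n => [|[|m]] //=; first exact: XE.
- exact/Eeq_sym/rep_Eeq.
- exact: Eeq_refl.
Qed.

(* Los's theorem. Witnesses chosen in [V_c] are regressive in c, hence stabilise,
   so that the limit structure is [V_kappa] itself. *)
Lemma large_Los (E : set K) phi :
  (forall H (Y : nat -> set Ens), ~ small H ->
    (forall k x, Y k x <-> Vk x /\ ev (le := le) H [set c | X c k x]) ->
    ev (le := le) H [set c | fo_sat (V (below le c)) (X c) (fun=> a) phi <->
                             fo_sat Vk Y (fun=> a) phi] ->
    ev (le := le) H E) ->
  large (le := le) E.
Proof.
move=> EP; have [k0] := inhK hK.
have /choice[F FP] (ic : (fo * seq W) * K) : exists o, wit ic.1 ic.2 o by exact: wit_ex.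
pose rkO (o : option W) := oapp (rk \o sval) k0 o.
apply: (large_stable hK (I := [set: fo * seq W]) (V := setT) (rk := rkO)
  (F := fun i c => F (i, c))).
- have -> : [set: fo * seq W] = [set: fo] `*` [set: seq W] by apply/predeqP.
  apply: (le_setX hK).
    exact/(small_le hK)/(countable_small hK)/countable_fo.
  apply: (le_seq hK); apply: (enumerate hK (rk := rk \o sval)) => b.
  by apply: (sub_small _ (small_rank b)) => w [].
- move=> b; apply: (@sub_small _ _ _ (some @` [set w : W | le (rk (sval w)) b] `|` [set None])).
    by move=> [w|] [_ wb]; [left; exists w|right].
  by apply: (smallU hK); [exact: image_small|exact: (small1 hK)].
- move=> i _; exists k0 => c _ kc; split=> //; have /= := FP (i, c).
  case: (F _) => [[x [Vx rx]] [xc _]|_] //; exact/(rkP Vx).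
move=> H bH HP; pose Y k := [set x | Vk x /\ ev (le := le) H [set c | X c k x]].
apply: (EP H Y) => //.
have YE k x y : Eeq x y -> Y k x -> Y k y.
  move=> xy [Vx ex]; split; first exact: Vstage_Eeq Vx.
  by apply: (sub_ev ex) => c _; exact: XE.
suff los psi l : ev (le := le) H [set c | fo_sat (V (below le c)) (X c) (env l) psi <->
    fo_sat Vk Y (env l) psi].
  have -> : (fun=> a) = env [::] by apply/funext => n; rewrite /env nth_nil.
  exact: los.
elim: psi l => [i j|i j|i k||psi1 IH1 psi2 IH2|psi IH] l; try exact: (evT hK).
(* An atomic formula on classes is decided through a dummy quantifier, whence the shift to [i.+1].
   In the case [None] the quantifier is instantiated at the empty set, which lies in the level since
   [k0 ≺ c]. *)
- have [o _ eo] := HP (FIn i.+1 k, l) Logic.I.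
  have eo' := evI hK eo (ev_gt H k0).
  case: o {eo} eo' => [w|] eo.
    have eX : ev (le := le) H [set c | ~ X c k (env l i)].
      by apply: (sub_ev eo) => c _ [/= Fc _]; have /= := FP (FIn i.+1 k, l, c); rewrite Fc => -[].
    apply: (sub_ev eX) => c _ /= nX; split=> // -[_ eX'].
    by have [c' _ []] := ev_ex hK bH (evI hK eX eX').
  have eX : ev (le := le) H [set c | X c k (env l i)].
    apply: (sub_ev eo) => c _ [/= Fc kc]; have /= := FP (FIn i.+1 k, l, c); rewrite Fc /=.
    apply; apply: (_ : V _ (MkEns (fun i : False => match i with end))); exists k0 => // -[].
  by apply: (sub_ev eX) => c _ /= Xc; split=> // _; split=> //; exact: Venv.
- by apply: (sub_ev (evI hK (IH1 l) (IH2 l))) => c _ [/= -> ->].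
have [[w|] _ ew] := HP (psi, l) Logic.I.
  have ew' := evI hK ew (IH (w :: l)).
  have nw : ~ fo_sat Vk Y (env l) (FAll psi).
    move=> /= /(_ (sval w)); rewrite -env_cons => Yw.
    have [c _ [/= Fc los]] := ev_ex hK bH ew'; have /= := FP (psi, l, c); rewrite Fc => -[_].
    by apply; apply/los/Yw; case: (svalP w).
  apply: (sub_ev ew) => c _ /= Fc; split=> // /(_ (sval w)); rewrite -env_cons => Xw.
  by have /= := FP (psi, l, c); rewrite Fc => -[wc]; case; exact: Xw.
(* Any [x] is in the late levels, which have no counterexample, so the induction hypothesis applies
   to its representative. *)
have Yall : fo_sat Vk Y (env l) (FAll psi).
  move=> /= x Vx; have := IH (toW Vx :: l).
  move=> /(evI hK (evI hK ew (ev_gt H (rk (rep x)))))/(ev_ex hK bH)[c _ [[/= Fc xc] los]].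
  have : fo_sat Vk Y (env (toW Vx :: l)) psi.
    apply/los; have /= := FP (psi, l, c); rewrite Fc env_cons /=; apply.
    have Vr := Vstage_Eeq (rep_Eeq x) Vx; exact/(rkP Vr).
  by apply: fo_sat_Eeq => // -[|n] /=; [exact/Eeq_sym/rep_Eeq|exact: Eeq_refl].
apply: (sub_ev ew) => c _ /= Fc; split=> // _; have /= := FP (psi, l, c); by rewrite Fc.
Qed.

End Los.

End Hierarchy.

(** * Reflection and the weakly compact filter *)

Section Reflection.
Context {K : smallType} {le : rel K} (hK : weakly_compact le).

Local Notation "x ≺ y" := (below le y x) (at level 70, no associativity).
Local Notation small := (@small K _).
Local Notation V := (Vstage le).
Local Notation Vk := (Vstage le [set: K]).

(** At each [c] where [Phi] fails, choose classes falsifying its matrix. Their limit along [H]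
    satisfies the matrix in [V_kappa], hence by [large_Los] so do the classes at late [c], where
    [Phi] must therefore hold. *)
Lemma large_reflection Phi A a : subclass Vk A -> Vk a -> models Vk Phi A a ->
  large (le := le) [set c | V (below le c) a /\
    models (V (below le c)) Phi (A `&` V (below le c)) a].
Proof.
move=> [AV AE] Va PhiA.
have [rep [rep_Eeq rep_eq]] := representative_ex; have [rk rkP] := rank_ex hK.
pose n := class_quantifiers Phi.
pose N c := A `&` V (below le c).
have subN c : subclass (V (below le c)) (N c).
  by split=> [x []//|x y xy [Ax Vx]]; split; [exact: AE Ax|exact: Vstage_Eeq Vx].
pose falsifies c (Y : nat -> set Ens) := [/\ forall k, subclass (V (below le c)) (Y k),
  forall k, Y (n + k)%N = N c & models (V (below le c)) Phi (N c) a \/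
    ~ fo_sat (V (below le c)) Y (fun=> a) (matrix Phi)].
have /choice[X XP] c : exists Y, falsifies c Y.
  have [m|nm] := EM (models (V (below le c)) Phi (N c) a).
    by exists (fun=> N c); split=> //; left.
  apply: contrapT => nY; apply: nm; apply/pi11_satP => Y Yn YN; apply: contrapT => nf.
  apply: nY; exists Y; split=> // [k|]; last by right.
  have [/Yn//|kn] := ltnP k n.
  by rewrite -(subnKC kn) YN; exact: subN.
have XE c k x y : Eeq x y -> X c k x -> X c k y.
  by move=> xy; case: (XP c) => /(_ k)[_ Xk] _ _; exact: Xk.
apply: (large_Los hK rep_Eeq rep_eq rkP XE Va (phi := matrix Phi)) => H Y bH YP los.
have YX : fo_sat Vk Y (fun=> a) (matrix Phi).
  apply: (pi11_satP _ _ _ _).1 PhiA _ _ _ => k.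
    move=> _; split=> [x /YP[]//|x y xy /YP[Vx ex]]; apply/YP; split.
      exact: Vstage_Eeq Vx.
    by apply: (sub_ev ex) => c _; exact: XE.
  (* The free classes are [A] cut down to the levels, and their limit is [A]. *)
  apply/predeqP => x; have XN c : X c (n + k)%N = N c by case: (XP c).
  split=> [/YP[Vx ex]|Ax].
    by have [c _] := ev_ex hK bH ex; rewrite /= XN => -[].
  apply/YP; split; first exact: AV.
  by exists (rk x) => c _ xc; rewrite /= XN; split=> //; apply/rkP => //; exact: AV.
apply: (sub_ev (evI hK los (ev_gt H (rk a)))) => c _ [/= losc ac]; split; first exact/(rkP _ Va).
by have [_ _ []] := XP c => // /(_ (losc.2 YX)).
Qed.

Lemma wc_filter_large R : wc_filter le R ->
  large (le := le) [set c | forall x : Pk K K, set_val x = below le c -> R x].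
Proof.
pose F : set_system (Pk K K) := [set R | large (le := le)
  [set c | forall x : Pk K K, set_val x = below le c -> R x]].
suff : wc_filter le `<=` F by apply.
apply: smallest_sub.
  split=> [|A B FA FB|A B AB FA].
  - by have [k0] := inhK hK; apply: largeS (large_gt k0) _.
  - apply: largeS (largeI hK FA FB) _ => c [cA cB] x xc; split; [exact: cA|exact: cB].
  - by apply: largeS FA _ => c cA x /cA; exact: AB.
move=> _ [Phi [A [a [sA Va PhiA ->]]]].
apply: largeS (large_reflection sA Va PhiA) _ => c [ca cPhi] x xc.
by exists c.
Qed.

(** The von Neumann ordinals; [ord x] has rank [x]. *)
Lemma ordinals_ex : exists ord : K -> Ens,
  (forall D x, (forall y z, D z -> y ≺ z -> D y) -> V D (ord x) <-> D x) /\
  (forall z x, Emem z (ord x) <-> exists2 y, y ≺ x & Eeq z (ord y)).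
Proof.
have [ord ordE] := wf_rec hK (MkEns (fun i : False => match i with end))
  (F := fun x f => MkEns (fun y : {y | y ≺ x} => f (sval y)))
  (fun x f g fg => congr1 (@MkEns _) (funext (fun y => fg _ (svalP y)))).
have ordP z x : Emem z (ord x) <-> exists2 y, y ≺ x & Eeq z (ord y).
  rewrite ordE; split=> [[[y yx] zy]|[y yx zy]]; first by exists y.
  by exists (exist _ y yx).
exists ord; split=> // D x; elim/(well_founded_ind (lt_wf hK)): x D => x IH D Dini.
have belowT b y z : z ≺ b -> y ≺ z -> y ≺ b by move=> zb yz; exact: (lt_trans hK yz zb).
split=> [/VstageP[b Db bx]|Dx].
  have [->//|/(lt_total hK)[xb|bx']] := EM (x = b); first exact: Dini Db xb.
  have /(IH _ bx' _ (@belowT b)) : V (below le b) (ord b).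
    by apply: bx; apply/ordP; exists b => //; exact: Eeq_refl.
  by move=> bb; case: (ltxx bb).
apply/VstageP; exists x => // z /ordP[y yx zy]; apply: (Vstage_Eeq (Eeq_sym zy)).
exact/(IH _ yx _ (@belowT x)).
Qed.

Context (ord : K -> Ens).
Context (Vord : forall D x, (forall y z, D z -> y ≺ z -> D y) -> V D (ord x) <-> D x).
Context (ordP : forall z x, Emem z (ord x) <-> exists2 y, y ≺ x & Eeq z (ord y)).

Lemma V_ord c x : V (below le c) (ord x) <-> x ≺ c.
Proof. by apply: Vord => y z zc yz; exact: (lt_trans hK yz zc). Qed.

Lemma Vk_ord x : Vk (ord x).
Proof. exact/Vord. Qed.

Lemma ord_inj x y : Eeq (ord x) (ord y) -> x = y.
Proof.
move=> xy; apply: contrapT => /(lt_total hK)[xy'|yx'].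
  exact: (ltxx ((V_ord _ _).1 (Vstage_Eeq xy ((V_ord _ _).2 xy')))).
exact: (ltxx ((V_ord _ _).1 (Vstage_Eeq (Eeq_sym xy) ((V_ord _ _).2 yx')))).
Qed.

Lemma Emem_ord x y : Emem (ord x) (ord y) <-> x ≺ y.
Proof.
split=> [/ordP[z zy /ord_inj -> //]|xy]; apply/ordP; exists x => //; exact: Eeq_refl.
Qed.

Lemma below_inj c c' : below le c = below le c' -> c = c'.
Proof.
move=> E; apply: contrapT => /(lt_total hK)[cc|cc].
  by move: (cc); rewrite -E; exact: ltxx.
by move: (cc); rewrite E; exact: ltxx.
Qed.

Definition fneg phi := FImp phi FBot.

(* For each x there is p in A with p \notin x and p <> x; if A consists of
   ordinals, this says that A is unbounded. *)
Definition unbounded_formula : fo :=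
  FAll (fneg (FAll (FImp (FIn 0 0) (FImp (fneg (FMem 0 1)) (fneg (fneg (FEq 0 1))))))).

(** [A] codes the closure points of [f], which are unbounded in kappa. Where this reflects, [c] is a
    limit of closure points, hence one itself. *)
Lemma wc_filter_closed (f : K -> K) : wc_filter le
  [set x | exists2 c, set_val x = below le c & forall y, y ≺ c -> f y ≺ c].
Proof.
pose closed c := forall y, y ≺ c -> f y ≺ c.
pose A := [set x | exists2 c, closed c & Eeq x (ord c)].
have [k0] := inhK hK.
have F : wc_filter le (reflection_set le (Matrix unbounded_formula) A (ord k0)).
  apply: sub_gen_smallest; exists (Matrix unbounded_formula), A, (ord k0); split=> //.
  - split=> [x [c _ /Eeq_sym xc]|x y xy [c cc xc]].
      exact: Vstage_Eeq xc (Vk_ord c).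
    exists c => //; exact: Eeq_trans (Eeq_sym xy) xc.
  - exact: Vk_ord.
  - move=> x /VstageP[b _ bx] /= nx.
    have [c [cc bc]] := large_ex hK (largeI hK (large_closed hK f) (large_gt b)).
    apply: (nx (ord c) (Vk_ord c)); first by exists c => //; exact: Eeq_refl.
      by move=> /bx/V_ord cb; exact: (ltxx (lt_trans hK bc cb)).
    move=> cx; have /bx/V_ord : Emem (ord b) x by apply: Emem_Eeqr cx _; exact/Emem_ord.
    exact: ltxx.
apply: (filterS _ F) => x [c [xc _ cA]]; exists c => // y yc; apply: contrapT => fyc.
have /V_ord yV := yc; apply: (cA _ yV) => p Vp [[e ce pe] _] /= npy npy'.
have ec : e ≺ c by apply/V_ord; exact: Vstage_Eeq pe Vp.
have ye : y ≺ e.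
  apply/(ltNge hK) => ey; have [{}ey|{}ey] := le_eqVlt ey.
    by apply: npy'; rewrite -ey.
  by apply: npy; apply: Emem_Eeql (Eeq_sym pe) _; exact/Emem_ord.
by apply: fyc; apply: (lt_trans hK) ec; exact: ce.
Qed.

(** With [i = j] this says that the variable codes a condition, since conditions are compatible with
    themselves. *)
Definition compatible_formula (i j : nat) : fo :=
  fneg (FAll (FImp (FIn 0 1) (FImp (FMem i.+1 0) (fneg (FMem j.+1 0))))).

(* Class variable 0 is an arbitrary class X and 1 is the compatibility relation:
   if the codes in X form a predense antichain, then X is contained in a set. *)
Definition bounded_antichains_formula : pi11 :=
  ForallClass (Matrix
    (FImp (FAll (FAll (FImp (FIn 0 0) (FImp (FIn 1 0)
       (FImp (compatible_formula 0 1) (FEq 0 1))))))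
    (FImp (FAll (FImp (compatible_formula 0 0)
       (fneg (FAll (FImp (FIn 0 0) (fneg (compatible_formula 1 0)))))))
    (fneg (FAll (fneg (FAll (FImp (FIn 0 0)
       (FImp (compatible_formula 0 0) (FMem 0 1)))))))))).

(** * Regularity of the suborders coded by ordinals *)

Section Layers.
Context {d : Order.disp_t} {P : porderType d} (Q : set P) (s : K -> P) (sQ : range s = Q).

Let cQ i j := compatible Q (s i) (s j).

Let Qs i : Q (s i). Proof. by rewrite -sQ; exists i. Qed.

(* Compatibility is symmetric, so unordered pairs code it. *)
Let A := [set x | exists i j, cQ i j /\ forall z, Emem z x <-> Eeq z (ord i) \/ Eeq z (ord j)].

Let subA : subclass Vk A.
Proof.
split=> [x [i [j [_ xP]]]|x y xy [i [j [cij xP]]]].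
  have [b bP] := bounded hK (fun e : bool => if e then i else j)
    (countable_small hK (countableP [set: bool])).
  apply/VstageP; exists b => // z /xP[] zi; apply: (Vstage_Eeq (Eeq_sym zi)); apply/V_ord.
    exact: (bP true).
  exact: (bP false).
exists i, j; split=> // z; rewrite -xP; split; apply: Emem_Eeqr; [exact: Eeq_sym|exact: xy].
Qed.

Let pair_ex (D : set K) i j b : D b -> i ≺ b -> j ≺ b -> cQ i j ->
  exists p, [/\ V D p, A p, Emem (ord i) p & Emem (ord j) p].
Proof.
move=> Db ib jb cij.
pose p := MkEns (fun e : bool => ord (if e then i else j)).
have pP z : Emem z p <-> Eeq z (ord i) \/ Eeq z (ord j).
  by split=> [[[] ?]|[]]; [left|right|exists true|exists false].
exists p; split.
- by exists b => // -[]; apply/V_ord.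
- by exists i, j; split.
- by apply/pP; left; exact: Eeq_refl.
- by apply/pP; right; exact: Eeq_refl.
Qed.

Let A_compatible p x y : A p -> Emem x p -> Emem y p ->
  exists i j, [/\ Eeq x (ord i), Eeq y (ord j) & cQ i j].
Proof.
move=> [i [j [cij pP]]] /pP xp /pP yp.
case: xp => xp; case: yp => yp.
- by exists i, i; split=> //; apply: compatible_refl.
- by exists i, j.
- by exists j, i; split=> //; apply: compatible_sym.
- by exists j, j; split=> //; apply: compatible_refl.
Qed.

Let compatible_formulaP M (X : nat -> set Ens) e i j :
  fo_sat M X e (compatible_formula i j) <->
  exists p, [/\ M p, X 1%N p, Emem (e i) p & Emem (e j) p].
Proof.
split=> [n|[p [Mp Xp ip jp]]] /=; last by apply; [exact: Mp|exact: Xp|exact: ip|exact: jp].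
apply: contrapT => np; apply: n => p Mp Xp ip jp; apply: np; by exists p.
Qed.

Context (cc : forall B, antichain Q B -> small B).

(** Distinct codes in [X] give incompatible conditions, so by the chain condition they are few and
    lie below some [b]; [ord b] contains [X]. *)
Let models_bounded a : models Vk bounded_antichains_formula A a.
Proof.
move=> X [XV XE] anti _ nb.
pose I := [set i | X (ord i)].
have sI i j : I i -> I j -> cQ i j -> i = j.
  move=> Ii Ij cij; apply: ord_inj.
  have [b bP] := bounded hK (fun e : bool => if e then i else j)
    (countable_small hK (countableP [set: bool])).
  have := anti _ (Vk_ord j) _ (Vk_ord i) Ii Ij; apply.
  by apply/compatible_formulaP; exact: pair_ex (bP true Logic.I) (bP false Logic.I) cij.
have smI : small I.
  apply: card_le_small (cc (B := s @` I) _).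
    apply: (card_le_inj (f := s)) => [i Ii|i j Ii Ij sij]; first by exists i.
    apply: sI => //; rewrite /cQ sij; exact: compatible_refl.
  split=> [_ [i _ <-]//|_ _ [i Ii <-] [j Ij <-] sij cij].
  by apply: sij; rewrite (sI i j).
have [b bP] := bounded hK id smI.
apply: (nb (ord b) (Vk_ord b)) => x Vx Xx /compatible_formulaP[p [_ Ap xp _]].
have [i [_ [xi _ _]]] := A_compatible Ap xp xp.
apply: Emem_Eeql (Eeq_sym xi) _; apply/Emem_ord; apply: bP; exact: XE xi Xx.
Qed.

(** The analogue of [reaches] for codes: it yields the function under which alpha has to be
    closed. *)
Let closing_ex y : exists b, [/\ y ≺ b,
  forall i j, le i y -> le j y -> cQ i j -> exists k, [/\ k ≺ b, (s k <= s i)%O & (s k <= s j)%O] &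
  forall I, I `<=` [set i | le i y] -> (exists k, forall i, I i -> ~ cQ k i) ->
    exists2 k, k ≺ b & forall i, I i -> ~ cQ k i].
Proof.
have /choice[w wP] (ij : K * K) : exists k, cQ ij.1 ij.2 -> (s k <= s ij.1)%O /\ (s k <= s ij.2)%O.
  have [[r []]|nc] := EM (cQ ij.1 ij.2); last by exists y.
  by rewrite -sQ => -[k _ <-] ki kj; exists k.
have /choice[u uP] (I : set K) : exists k, (exists k, forall i, I i -> ~ cQ k i) ->
    forall i, I i -> ~ cQ k i.
  by have [[k kI]|nk] := EM (exists k, forall i, I i -> ~ cQ k i); [exists k|exists y].
have [b1 yb1] := exists_gt hK y.
have sy := small_seg hK y.
have [b2 b2P] := bounded hK w (small_setX hK sy sy).
have [b3 b3P] := bounded hK u (small_powerset hK sy).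
have [b bP] := bounded hK (fun i : 'I_3 => nth b1 [:: b1; b2; b3] i)
  (countable_small hK (countableP [set: 'I_3])).
have b1b : b1 ≺ b by exact: (bP (Ordinal (isT : 0 < 3)%N)).
have b2b : b2 ≺ b by exact: (bP (Ordinal (isT : 1 < 3)%N)).
have b3b : b3 ≺ b by exact: (bP (Ordinal (isT : 2 < 3)%N)).
exists b; split=> [|i j iy jy /(wP (i, j))[wi wj]|I Iy kI].
- exact: (lt_trans hK) b1b.
- by exists (w (i, j)); split=> //; apply: (lt_trans hK) b2b; exact: (b2P (i, j)).
- by exists (u I); [apply: (lt_trans hK) b3b; exact: b3P|exact: uP].
Qed.

Lemma wc_filter_regular : wc_filter le [set x : Pk K K | Reg K Q (s @` set_val x)].
Proof.
have /choice[f fP] := closing_ex; have [k0] := inhK hK.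
have F : wc_filter le (reflection_set le bounded_antichains_formula A (ord k0)).
  apply: sub_gen_smallest; exists bounded_antichains_formula, A, (ord k0); split=> //.
  exact: Vk_ord.
apply: (filterS _ (filterI F (wc_filter_closed f))).
move=> x [[c [xc _ cPhi]] [c' xc' cf]].
have cc' : c' = c by apply: below_inj; rewrite -xc -xc'.
rewrite cc' in cf; rewrite /= xc.
have lt2 i j : i ≺ c -> j ≺ c -> exists m, [/\ m ≺ c, le i m & le j m].
  move=> ic jc; have [ij|ji] := le_total hK i j.
    by exists j; split=> //; exact: lexx.
  by exists i; split=> //; exact: lexx.
have cR i j : i ≺ c -> j ≺ c -> cQ i j -> compatible (s @` below le c) (s i) (s j).
  move=> ic jc cij; have [m [mc im jm]] := lt2 _ _ ic jc.
  have [_ /(_ _ _ im jm cij)[k [kf ki kj]] _] := fP m.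
  by exists (s k); split=> //; exists k => //; exact: (lt_trans hK kf (cf _ mc)).
split; last first.
  exact/(small_card_lt hK)/image_small/(small_below hK).
have RQ : s @` below le c `<=` Q by move=> _ [i _ <-].
split=> // [_ _ [i ic <-] [j jc <-] nij /(cR _ _ ic jc)//|B /maximal_antichainP[[BR aB] mB]].
apply/maximal_antichainP; split.
  split=> [|p q Bp Bq pq]; first exact: subset_trans RQ.
  have [i ic ip] := BR _ Bp; have [j jc jq] := BR _ Bq.
  by rewrite -ip -jq => /(cR _ _ ic jc); rewrite ip jq; exact: aB.
move=> q Qq; apply: contrapT => nq.
(* As [s] may repeat values, [r] selects one code for each element of [B]; the formula asks
   compatible codes to be equal. *)
have /choice[r rP] p : exists i, B p -> i ≺ c /\ s i = p.
  by case: (EM (B p)) => [/BR[i ic ip]|]; [exists i|exists k0].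
pose X := [set x | exists2 p, B p & Eeq x (ord (r p))].
have pairs i j : i ≺ c -> j ≺ c -> cQ i j -> exists p,
    [/\ V (below le c) p, (A `&` V (below le c)) p, Emem (ord i) p & Emem (ord j) p].
  move=> ic jc cij; have [m [mc im jm]] := lt2 _ _ ic jc.
  have [mf _ _] := fP m.
  have [p [Vp Ap ip jp]] := pair_ex (cf _ mc : below le c (f m))
    (le_lt_trans hK im mf) (le_lt_trans hK jm mf) cij.
  by exists p.
have XV : subclass (V (below le c)) X.
  split=> [x' [p Bp xp]|x' y' xy [p Bp xp]].
    apply: (Vstage_Eeq (Eeq_sym xp)); apply/V_ord; by case: (rP p Bp).
  by exists p => //; exact: Eeq_trans (Eeq_sym xy) xp.
(* The reflected formula, applied to the codes of [B], bounds them strictly below [c]. *)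
have [x0 [Vx0 x0P]] : exists x0, V (below le c) x0 /\
    forall p, B p -> Emem (ord (r p)) x0.
  apply: contrapT => nx0; apply: (cPhi X XV).
  - move=> x' Vx' y' Vy' [q' Bq yq] [p Bp xp] /compatible_formulaP[t [_ [At _] yt xt]].
    have [i [j [/= yi xj cij]]] := A_compatible At yt xt.
    have Ei : r q' = i by apply: ord_inj; exact: Eeq_trans (Eeq_sym yq) yi.
    have Ej : r p = j by apply: ord_inj; exact: Eeq_trans (Eeq_sym xp) xj.
    have [qc qs] := rP q' Bq; have [pc ps] := rP p Bp.
    rewrite -{i}Ei -{j}Ej in yi xj cij.
    have /esym E : q' = p.
      apply: contrapT => qp; apply: (aB q' p Bq Bp qp).
      by rewrite -qs -ps; exact: cR.
    by apply: Eeq_trans yi (Eeq_sym _); rewrite -E.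
  - move=> x' Vx' /compatible_formulaP[t [_ [At _] xt _]] nX.
    have [i [_ [/= xi _ _]]] := A_compatible At xt xt.
    have ic : i ≺ c by apply/V_ord; exact: Vstage_Eeq xi Vx'.
    have [|p Bp ip] := mB (s i); first by exists i.
    have [pc ps] := rP p Bp.
    have [t' [Vt' At' it' pt']] : exists t', [/\ V (below le c) t', (A `&` V (below le c)) t',
        Emem (ord i) t' & Emem (ord (r p)) t'].
      by apply: pairs => //; rewrite /cQ ps; exact: sub_compatible ip.
    apply: (nX (ord (r p))); first exact/V_ord.
      by exists p => //; exact: Eeq_refl.
    apply/compatible_formulaP; exists t'; split=> //=.
    exact: Emem_Eeql (Eeq_sym xi) it'.
  move=> x' Vx' nX; apply: nx0; exists x'; split=> // p Bp; have [pc ps] := rP p Bp.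
  apply: (nX (ord (r p))); first exact/V_ord.
    by exists p => //; exact: Eeq_refl.
  apply/compatible_formulaP.
  have [|t' [Vt' At' it' _]] := pairs _ _ pc pc; first exact: compatible_refl.
  by exists t'.
have /VstageP[b bc bx0] := Vx0.
(* A failure of maximality in [Q] now has a witness with a code below [f b], hence below [c],
   against maximality in the suborder. *)
have [_ _ /(_ (r @` B))[||k kb kB]] := fP b.
- by move=> _ [p Bp <-]; apply: ltW; apply/V_ord/bx0/x0P.
- move: Qq; rewrite -sQ => -[k _ kq]; exists k => _ [p Bp <-] kp.
  have [_ ps] := rP p Bp.
  by apply: nq; exists p => //; move: kp; rewrite /cQ kq ps.
have [|p Bp kp] := mB (s k).
  by exists k => //; exact: (lt_trans hK kb (cf _ bc)).
apply: (kB (r p)); first by exists p.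
by have [_ ps] := rP p Bp; rewrite /cQ ps; exact: sub_compatible kp.
Qed.

End Layers.

End Reflection.

(** * Chain condition and complete layering *)

Section Layered.
Context {K : smallType} {le : rel K} (hK : weakly_compact le).
Context {d : Order.disp_t} {P : porderType d}.

Lemma chain_condition_layered :
  chain_condition P K -> completely_layered P (wc_filter le).
Proof.
move=> cc; split=> [X XK|Q [_ Qc _] QK]; first exact: (regular_suborder_ex hK).
split=> // s sQ; have [ord [Vord ordP]] := ordinals_ex hK.
apply: (wc_filter_regular hK Vord ordP sQ) => B [BQ aB].
apply/(small_card_lt hK)/cc; split=> // p q Bp Bq pq.
by apply: Qc; [exact: BQ|exact: BQ|exact: aB].
Qed.

(** Extend a big antichain to a maximal one [B] of some [Q] of size at most kappa. For some [e],
    [s[e]] is regular and closed under [F], so it contains [B] although it is small. *)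
Lemma layered_chain_condition :
  completely_layered P (wc_filter le) -> chain_condition P K.
Proof.
move=> [Qex lay] A aA; apply/(small_card_lt hK); apply: contrapT => /(bigP hK)[h hA hi].
have [|Q [rQ QK hQ]] := Qex (range h); first exact: card_image_le.
have [_ /(_ _) layQ] := lay Q rQ QK.
have [k0] := inhK hK.
have [|B mB hB] := @maximal_antichain_ex _ _ Q (range h).
  split=> // _ _ [x _ <-] [y _ <-] hxy /(sub_compatible (@subsetT _ Q)).
  exact: aA.2 (hA x) (hA y) hxy.
have [[BQ _] QB] := (maximal_antichainP _ _).1 mB.
have /choice[F FP] q : exists a, Q q -> B a /\ compatible Q q a.
  by case: (EM (Q q)) => [/QB[a]|]; [exists a|exists q].
have [c _ ci] := card_le_fun k0 QK.
(* [s] inverts the coding [c], with a default in [Q] off the range of [c]. *)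
have /choice[s sP] k : exists p, Q p /\ forall q, Q q -> c q = k -> p = q.
  have [[q [Qq cq]]|nq] := EM (exists q, Q q /\ c q = k).
    by exists q; split=> // q' Qq' cq'; apply: ci; rewrite ?cq.
  exists (h k0); split=> [|q Qq cq]; first by apply: hQ; exists k0.
  by case: nq; exists q.
have sQ : range s = Q.
  apply/seteqP; split=> [_ [k _ <-]|q Qq]; first by case: (sP k).
  by exists (c q) => //; apply: (sP (c q)).2.
have sF k : F (s k) = s (c (F (s k))).
  by apply/esym/(sP _).2 => //; apply/BQ/(FP (s k) (sP k).1).1.
have [e [eR ef]] := large_ex hK (largeI hK (wc_filter_large hK (layQ s sQ))
  (large_closed hK (fun k => c (F (s k))))).
have se : Pk K K (below le e) by apply/(small_card_lt hK)/(small_below hK).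
have [rR _] := eR (SigSub (mem_set se)) erefl.
have BR : B `<=` s @` below le e.
  apply: (maximal_antichain_trace (F := F) mB rR) => _ [k ke <-].
  have [BF cF] := FP (s k) (sP k).1; split=> //.
  by rewrite sF; exists (c (F (s k))) => //; exact: ef.
have : small (K := K) (range h).
  exact/(sub_small (subset_trans hB BR))/image_small/(small_below hK).
by apply/(bigP hK); exists h => // k; exists k.
Qed.

End Layered.

Theorem theorem1p7 (K : smallType) (le : rel K) (hK : weakly_compact le)
    (d : Order.disp_t) (P : porderType d) :
  [<-> chain_condition P K;
       Knaster P K;
       stationarily_layered P le;
       completely_layered P (wc_filter le)].
Proof.
tfae.
- exact: (chain_condition_Knaster hK).
- by move=> /(Knaster_chain_condition hK); exact: (chain_condition_stationary hK).
- by move=> /(stationary_chain_condition hK); exact: (chain_condition_layered hK).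
- exact: (layered_chain_condition hK).
Qed.
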